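(* Let $n\in\{2,3\}$ and let $(\epsilon_0,\epsilon_1)\in[0,\tfrac12]^2\setminus\{(0,0)\}$. Then the probabilistic cellular automaton $\tilde H_n$ with parameters $(\epsilon_0,\epsilon_1)$ is ergodic, and almost surely there is no draw in the percolation game on $\mathbb{Z}^2$ with parameters $(n,\epsilon_0,\epsilon_1)$ started at $(0,0)$.
   Context: Fix an integer $n\ge 2$ and reals $\epsilon_0,\epsilon_1\in[0,1]$ with $\epsilon_0+\epsilon_1\le 1$, and put $r=1-\epsilon_0-\epsilon_1$. **The PCA $\tilde H_n$.** Its alphabet is the three-element set $\{0,1,?\}$. It is the time-homogeneous Markov chain $(X(t))_{t\ge0}$, $X(t)=(X_i(t):i\in\mathbb{Z})$, on $\{0,1,?\}^{\mathbb{Z}}$ such that, conditionally on $X(t)$, the variables $(X_i(t+1))_{i\in\mathbb{Z}}$ are independent, and the conditional law of $X_i(t+1)$ depends only on $(X_i(t),X_{i+1}(t),\dots,X_{i+n-1}(t))$ as follows. - If $X_{i+k}(t)=0$ for all $k\in\{0,\dots,n-1\}$, then $X_i(t+1)$ equals $0$ with probability $\epsilon_0$, $1$ with probability $1-\epsilon_0$, and $?$ with probability $0$. - If $X_{i+k}(t)=1$ for some $k\in\{0,\dots,n-1\}$, then $X_i(t+1)$ equals $0$ with probability $1-\epsilon_1$, $1$ with probability $\epsilon_1$, and $?$ with probability $0$. - If $(X_i(t),\dots,X_{i+n-1}(t))\in\{0,?\}^n\setminus\{(0,\dots,0)\}$, then $X_i(t+1)$ equals $0$ with probability $\epsilon_0$,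 $1$ with probability $\epsilon_1$, and $?$ with probability $r$. **Ergodicity.** The PCA is ergodic if there is a unique probability measure $\mu_\infty$ on $\{0,1,?\}^{\mathbb{Z}}$ (product topology) such that, for every probability measure $\mu_0$ on $\{0,1,?\}^{\mathbb{Z}}$, if $X(0)$ has law $\mu_0$ then the law of $X(t)$ converges weakly to $\mu_\infty$ as $t\to\infty$. **The percolation game.** Each site of $\mathbb{Z}^2$ is independently assigned one of three states: trap with probability $\epsilon_1$, target with probability $\epsilon_0$, open with probability $r$. This random board is known to both players. A token is placed at $(0,0)$ and two players alternately move it from its current position $(i,j)$ to a site of their choice in $\mathrm{Out}(i,j)=\{(i+k,j+1):k\in\{0,1,\dots,n-1\}\}$. A player who moves the token to a trap loses immediately; a player who moves it to a target wins immediately; if the destination is open, the game continues with the other player's turn. There is a draw if, with both players playing optimally, the game never ends, i.e. if neither player has a winning strategy on the given board; ''almost surely'' refers to the randomness of the board. *)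

(* Defs.v *)
From HB Require Import structures.
From mathcomp Require Import all_boot all_order all_algebra.
From mathcomp Require Import all_classical all_reals all_analysis.

Set Implicit Arguments.
Unset Strict Implicit.
Unset Printing Implicit Defensive.

Import Order.TTheory GRing.Theory Num.Theory.
Import numFieldNormedType.Exports.

Local Open Scope classical_set_scope.
Local Open Scope ring_scope.

Inductive letter := Zero | One | Unknown.

Definition letter_code (a : letter) : option bool :=
  match a with Zero => Some false | One => Some true | Unknown => None end.

Definition letter_decode (c : option bool) : letter :=
  match c with Some false => Zero | Some true => One | None => Unknown end.

Lemma letter_codeK : cancel letter_code letter_decode.
Proof. by case. Qed.

HB.instance Definition _ := Countable.copy letter (can_type letter_codeK).
HB.instance Definition _ := isPointed.Build letter Zero.
HB.instance Definition _ := hasNbhs.Build letter principal_filter.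
HB.instance Definition _ := Discrete_ofNbhs.Build letter erefl.

Definition config : Type := prod_topology (fun _ : int => letter).

HB.instance Definition _ :=
  Topological.copy config (prod_topology (fun _ : int => letter)).
HB.instance Definition _ := isPointed.Build config (fun _ => Zero).

Definition borel (T : ptopologicalType) := g_sigma_algebraType (@open T).

HB.instance Definition _ (T : ptopologicalType) :=
  Measurable.on (borel T).

Definition weak_cvg (R : realType) (T : ptopologicalType)
    (mu : nat -> probability (borel T) R) (m : probability (borel T) R) : Prop :=
  forall f : T -> R, continuous f -> (exists M, forall x, `|f x| <= M) ->
    (fun t => \int[mu t]_x (f x)%:E)%E @ \oo --> (\int[m]_x (f x)%:E)%E.

(* In the last case the pattern is neither all [Zero] nor contains [One], i.e.
   it lies in {0,?}^n minus (0,...,0). *)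
Definition local_rule (R : realType) (n : nat) (e0 e1 : R)
    (w : 'I_n -> letter) (b : letter) : R :=
  if [forall k, w k == Zero] then
    match b with Zero => e0 | One => 1 - e0 | Unknown => 0 end
  else if [exists k, w k == One] then
    match b with Zero => 1 - e1 | One => e1 | Unknown => 0 end
  else
    match b with Zero => e0 | One => e1 | Unknown => 1 - e0 - e1 end.

Definition window (n : nat) (x : config) (i : int) : 'I_n -> letter :=
  fun k => x (i + k%:Z).

Definition history_sigma (d : measure_display) (Omega : measurableType d)
    (X : nat -> Omega -> borel config) (t : nat) : set (set Omega) :=
  <<s [set A | exists2 s, (s <= t)%N &
               exists2 B, measurable B & A = X s @^-1` B] >>.

(* Markov property and transition law together: for every event [A] of the
   past up to time [t],
     P(A, X_i(t+1) = a_i for i in F)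
       = E[1_A * \prod_(i in F) p(a_i | X_i(t), ..., X_{i+n-1}(t))],
   i.e. given X(0), ..., X(t) the X_i(t+1) are independent with the local law
   prescribed by X(t). *)
Definition pca_chain (R : realType) (n : nat) (e0 e1 : R) (d : measure_display)
    (Omega : measurableType d) (P : probability Omega R)
    (X : nat -> {RV P >-> borel config}) : Prop :=
  forall (t : nat) (A : set Omega) (F : seq int) (a : int -> letter),
    history_sigma (fun s => X s : Omega -> borel config) t A -> uniq F ->
    P (A `&` [set w | forall i, i \in F -> (X t.+1 w : config) i = a i]) =
    (\int[P]_(w in A)
       (\prod_(i <- F) local_rule e0 e1 (@window n (X t w) i) (a i))%:E)%E.

Definition attracting (R : realType) (n : nat) (e0 e1 : R)
    (mu : probability (borel config) R) : Prop :=
  forall (mu0 : probability (borel config) R) (d : measure_display)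
    (Omega : measurableType d) (P : probability Omega R)
    (X : nat -> {RV P >-> borel config}),
    pca_chain n e0 e1 X ->
    (forall B, measurable B -> distribution P (X 0%N) B = mu0 B) ->
    weak_cvg (fun t => distribution P (X t)) mu.

(* Uniqueness is equality on measurable sets: the library's measures are total
   functions on sets, with irrelevant values off the sigma-algebra. *)
Definition ergodic (R : realType) (n : nat) (e0 e1 : R) : Prop :=
  exists mu : probability (borel config) R,
    attracting n e0 e1 mu /\
    forall nu : probability (borel config) R, attracting n e0 e1 nu ->
      forall B, measurable B -> nu B = mu B.

Inductive site := Trap | Target | Open.

Definition board := (int * int)%type -> site.

(* A strategy picks the next increment [k] from the moves made so far; with the
   fixed starting point these determine all positions visited. *)
Definition strategy (n : nat) := seq 'I_n -> 'I_n.

(* The first player moves at even times. *)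
Fixpoint moves (n : nat) (s1 s2 : strategy n) (t : nat) : seq 'I_n :=
  if t is t'.+1 then
    let h := moves s1 s2 t' in rcons h ((if odd t' then s2 else s1) h)
  else [::].

Definition token (n : nat) (h : seq 'I_n) : int * int :=
  (\sum_(k <- h) (k : nat)%:Z, (size h)%:Z).

Inductive player := First | Second.

Definition mover (t : nat) : player := if odd t then Second else First.

Definition wins (n : nat) (b : board) (p : player) (s1 s2 : strategy n) : Prop :=
  exists t : nat,
    (forall s, (0 < s <= t)%N -> b (token (moves s1 s2 s)) = Open) /\
    (b (token (moves s1 s2 t.+1)) = Target /\ mover t = p \/
     b (token (moves s1 s2 t.+1)) = Trap /\ mover t <> p).

Definition draw (n : nat) (b : board) : Prop :=
  ~ (exists s1 : strategy n, forall s2 : strategy n, wins b First s1 s2) /\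
  ~ (exists s2 : strategy n, forall s1 : strategy n, wins b Second s1 s2).

Definition site_prob (R : realType) (e0 e1 : R) (s : site) : R :=
  match s with Trap => e1 | Target => e0 | Open => 1 - e0 - e1 end.

(* Meant for a finite [V] with the discrete sigma-algebra, whence arbitrary
   sets of values [A z]. *)
Definition mutually_independent (R : realType) (I : eqType) (V : Type)
    (d : measure_display) (Omega : measurableType d) (P : probability Omega R)
    (W : I -> Omega -> V) : Prop :=
  forall (F : seq I) (A : I -> set V), uniq F ->
    P [set w | forall z, z \in F -> A z (W z w)] =
    (\prod_(z <- F) fine (P (W z @^-1` A z)))%:E.

Definition iid_board (R : realType) (e0 e1 : R) (d : measure_display)
    (Omega : measurableType d) (P : probability Omega R)
    (W : int * int -> Omega -> site) : Prop :=
  [/\ forall z s, measurable (W z @^-1` [set s]),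
      forall z s, P (W z @^-1` [set s]) = (site_prob e0 e1 s)%:E
    & mutually_independent P W].

Definition almost_surely_no_draw (R : realType) (n : nat) (e0 e1 : R) : Prop :=
  forall (d : measure_display) (Omega : measurableType d)
    (P : probability Omega R) (W : int * int -> Omega -> site),
    iid_board e0 e1 P W ->
    {ae P, forall w, ~ draw n (fun z => W z w)}.

(* Main.v *)
From HB Require Import structures.
From mathcomp Require Import all_boot all_order all_algebra finmap.
From mathcomp Require Import all_classical all_reals all_analysis.
From mathcomp Require Import measurable_realfun.
From mathcomp Require Import ring lra zify.
Require Import Defs.

Set Implicit Arguments.
Unset Strict Implicit.
Unset Printing Implicit Defensive.

Import Order.TTheory GRing.Theory Num.Theory.
Import numFieldNormedType.Exports.

Local Open Scope classical_set_scope.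
Local Open Scope ring_scope.

(** The letter produced at a site by the automaton, when the sites of a row
    are read as noise (trap: [Zero], target: [One], open: apply the rule), tells
    whether the player who moves the token to that site loses ([Zero]) or wins
    ([One]); [Unknown] means that play may last longer than the time that has
    elapsed.
    The probabilities of [Zero] and [One] under the noise are those of a trap
    and of a target, so the game with parameters (e0, e1) belongs to the
    automaton with parameters (e1, e0); the hypotheses are symmetric.

    Everything follows from one fact: started from the configuration with
    all letters [Unknown], the automaton has a probability [unknown_prob] of
    an unknown letter that tends to 0 ([unknown_prob_cvg0]).

    Ergodicity.  Order the letters by information, [Unknown] being least.  The
    rule is monotone, so a chain started anywhere is at least as likely to show
    a given word without [Unknown] as the chain started from all [Unknown]
    ([word_mean_known_ge]).  When unknown letters disappear these lower bounds
    add up to 1, which pins down the limit of every word probability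
    ([word_mean_cvg]).  The limiting law exists as a measure: it is the law of
    the row of final values on a random board ([final_row_law]).  Continuous
    functions on the compact space of configurations are uniformly close to
    functions of finitely many letters, which gives weak convergence.

    The game.  A position whose value is known at some finite horizon is won by
    one of the players ([attack_wins]), and almost surely the positions
    reachable in one move have a known value ([almost_surely_decided]).

    Disappearance of unknown letters.  The word probabilities of the chain
    started from all [Unknown] converge; the limit [limit_mean] is stationary
    and invariant under shifts and reflection.  Without noise the stationary
    dynamics has a weight of unknown letters that cannot increase: for n = 2 a
    letter ? weighs 1, plus 1 if it is followed by 0, plus 1 if it is followed
    by 01; for n = 3 it weighs 1, plus 2 if it is followed by 0, plus 2 if it is
    followed by 001, minus 1 if it is followed by 0?.  The frequency of ? alone
    may grow in a step, at places where a ? meets a 0; the added terms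
    anticipate this growth.  With noise, stationarity gives exact linear
    equations between the frequencies of the few patterns that occur in the
    weight ([two_stationarity] and [three_unknown_vanishes]).  These equations,
    for n = 3 together with the inequality for the weight
    ([three_weight_loss]), leave 0 as the only possible frequency of unknown
    letters ([two_balance], [three_balance]). *)

(** * Words, the information order and the averaged dynamics *)

Definition letter_le (a b : letter) : bool := (a == Unknown) || (a == b).
Definition word_le : rel (seq letter) := all2 letter_le.

Definition open_value (w : seq letter) : letter :=
  if all (pred1 Zero) w then One else if has (pred1 One) w then Zero else Unknown.

Section Words.
Variables (R : realType) (m : nat) (e0 e1 : R).
Hypotheses (e0_ge0 : 0 <= e0) (e1_ge0 : 0 <= e1) (e01_le1 : e0 + e1 <= 1).

(** The letter imposed by the noise; [rule] splits the transition
    probabilities into an imposed letter and, with the remaining probability,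
    the outcome [open_value] of the deterministic rule.  All three cases of the
    transition law of the automaton have this common form. *)
Definition noise (b : letter) : R :=
  match b with Zero => e0 | One => e1 | Unknown => 0 end.

Definition rule (w : seq letter) (b : letter) : R :=
  noise b + (1 - e0 - e1) * (open_value w == b)%:R.

Fixpoint expect (ps : seq (letter -> R)) (f : seq letter -> R) : R :=
  if ps is p :: ps' then
    p Zero * expect ps' (fun v => f (Zero :: v)) +
    p One * expect ps' (fun v => f (One :: v)) +
    p Unknown * expect ps' (fun v => f (Unknown :: v))
  else f [::].

Definition update (k : nat) (f : seq letter -> R) (u : seq letter) : R :=
  expect [seq rule (take m.+1 (drop i u)) | i <- iota 0 k] f.

(** The expectation of [f] at the first [k] letters after [t] steps from [x].
    It is computed backwards, by letting the transition operator act on [f];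
    each step makes the word that is read [m] letters longer. *)
Fixpoint pca_mean (t k : nat) (f : seq letter -> R) (x : nat -> letter) : R :=
  if t is t'.+1 then pca_mean t' (k + m) (update k f) x else f (mkseq x k).

Definition start_mean t k f := pca_mean t k f (fun=> Unknown).

Lemma rule_ge0 w b : 0 <= rule w b.
Proof.
rewrite /rule addr_ge0//; first by case: b.
by rewrite mulr_ge0// subr_ge0; move: e01_le1; rewrite -lerBrDl.
Qed.

Lemma rule_sum w : rule w Zero + rule w One + rule w Unknown = 1.
Proof. by rewrite /rule; case: open_value => /=; ring. Qed.

Definition distr (p : letter -> R) :=
  (forall b, 0 <= p b) /\ p Zero + p One + p Unknown = 1.

Lemma rule_distr w : distr (rule w).
Proof. by split; [exact: rule_ge0 | exact: rule_sum]. Qed.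

Definition distrs := List.Forall distr.

Lemma distrs_rule (F : nat -> seq letter) s : distrs [seq rule (F i) | i <- s].
Proof. by elim: s => [|i s IH]; constructor => //; exact: rule_distr. Qed.

Lemma eq_expect ps f g : (forall v, size v = size ps -> f v = g v) ->
  expect ps f = expect ps g.
Proof.
elim: ps f g => [|p ps IH] f g fg /=; first exact: fg.
by congr (_ * _ + _ * _ + _ * _); apply: IH => v sv; apply: fg; rewrite /= sv.
Qed.

Lemma expect_lin ps a f b g :
  expect ps (fun v => a * f v + b * g v) = a * expect ps f + b * expect ps g.
Proof. by elim: ps f g => [//|p ps IH] f g /=; rewrite !IH; ring. Qed.

Lemma expect_lin3 ps a f b g c h :
  expect ps (fun v => a * f v + b * g v + c * h v) =
  a * expect ps f + b * expect ps g + c * expect ps h.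
Proof. by elim: ps f g h => [//|p ps IH] f g h /=; rewrite !IH; ring. Qed.

Lemma expect_cst ps c : distrs ps -> expect ps (fun=> c) = c.
Proof.
elim: ps => [//|p ps IH] H.
have [[_ p1] Hps] : distr p /\ distrs ps by inversion H.
by rewrite /= !IH// -!mulrDl p1 mul1r.
Qed.

Lemma expect_le ps f g : distrs ps ->
  (forall v, size v = size ps -> f v <= g v) -> expect ps f <= expect ps g.
Proof.
elim: ps f g => [|p ps IH] f g H fg /=; first exact: fg.
have [[p0 _] Hps] : distr p /\ distrs ps by inversion H.
by rewrite !lerD// ler_wpM2l// IH// => v sv; apply: fg; rewrite /= sv.
Qed.

Lemma expect_cat ps qs f :
  expect (ps ++ qs) f = expect ps (fun v => expect qs (fun w => f (v ++ w))).
Proof. by elim: ps f => [//|p ps IH] f /=; rewrite !IH. Qed.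

Lemma expect_exchange ps qs (f : seq letter -> seq letter -> R) :
  expect ps (fun v => expect qs (fun w => f v w)) =
  expect qs (fun w => expect ps (fun v => f v w)).
Proof.
by elim: ps f => [//|p ps IH] f /=; rewrite !IH expect_lin3.
Qed.

Lemma expect_rev ps f : expect (rev ps) f = expect ps (fun v => f (rev v)).
Proof.
elim: ps f => [//|p ps IH] f.
rewrite rev_cons -cats1 expect_cat expect_exchange /=.
by rewrite !IH; congr (_ * _ + _ * _ + _ * _); apply: eq_expect => v _;
  rewrite rev_cons cats1.
Qed.

Definition mono (f : seq letter -> R) :=
  forall u v, word_le u v -> f u <= f v.

Lemma letter_le_refl a : letter_le a a. Proof. by rewrite /letter_le eqxx orbT. Qed.
Lemma word_le_refl u : word_le u u.
Proof. by elim: u => //= a u ->; rewrite letter_le_refl. Qed.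

Lemma open_value_mono u v : word_le u v -> letter_le (open_value u) (open_value v).
Proof.
move=> uv; rewrite /open_value.
have [a0|] := boolP (all (pred1 Zero) u).
  suff -> : all (pred1 Zero) v by [].
  elim: u v a0 uv => [|a u IH] [|b v]//= /andP[/eqP-> a0] /andP[/eqP<- uv].
  by rewrite eqxx (IH v).
have [h1 _|//] := boolP (has (pred1 One) u).
have h2 : has (pred1 One) v.
  elim: u v h1 uv => [//|a u IH] [|b v]//=.
  move=> /orP[/eqP-> /andP[/eqP<- _]//|h1 /andP[_ uv]].
  by rewrite (IH v)// orbT.
rewrite h2; case: ifP => // /allP a0.
by move/hasP: h2 => [x xv /eqP x1]; have := a0 _ xv; rewrite x1.
Qed.

Definition distr_le (p p' : letter -> R) := p Zero <= p' Zero /\ p One <= p' One.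

Lemma rule_mono u v : word_le u v -> distr_le (rule u) (rule v).
Proof.
move=> /open_value_mono.
have r0 : 0 <= 1 - e0 - e1 by rewrite -addrA -opprD subr_ge0.
rewrite /rule; case: (open_value u) => //.
- by move=> /eqP <-.
- by move=> /eqP <-.
by move=> _; split; rewrite lerD2l mulr0 mulr_ge0.
Qed.

(** Coupling without a probability space.  A law that puts more mass on the
    two known letters arises from the other one by moving mass from [Unknown]
    upwards, and a monotone function gains by that; this is done letter by
    letter. *)
Lemma expect_mono ps ps' f f' : distrs ps -> distrs ps' ->
  List.Forall2 distr_le ps ps' ->
  mono f' -> (forall v, f v <= f' v) -> expect ps f <= expect ps' f'.
Proof.
move=> H H' HH mf' ff'; apply: (@le_trans _ _ (expect ps f')).
  by apply: expect_le.
elim: HH H H' f' mf' {f ff'} => {ps ps'} [//|p p' ps ps' pp' HH IH] H H' f' mf'.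
have [[p0 p1] Hps] : distr p /\ distrs ps by inversion H.
have [[p0' p1'] Hps'] : distr p' /\ distrs ps' by inversion H'.
have mf a : mono (fun v => f' (a :: v)).
  by move=> u v uv; apply: mf'; rewrite /= letter_le_refl.
have E a : expect ps (fun v => f' (a :: v)) <= expect ps' (fun v => f' (a :: v)).
  exact: IH.
have G a : expect ps' (fun v => f' (Unknown :: v)) <= expect ps' (fun v => f' (a :: v)).
  by apply: expect_le => // v _; apply: mf'; rewrite /= word_le_refl.
rewrite /=; apply: (@le_trans _ _ (p Zero * expect ps' (fun v => f' (Zero :: v)) +
  p One * expect ps' (fun v => f' (One :: v)) +
  p Unknown * expect ps' (fun v => f' (Unknown :: v)))).
  by rewrite !lerD// ler_wpM2l.
move: (G Zero) (G One) pp' => G0 G1 [pp0 pp1].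
have -> : p Unknown = 1 - p Zero - p One by rewrite -p1; ring.
have -> : p' Unknown = 1 - p' Zero - p' One by rewrite -p1'; ring.
nra.
Qed.

Lemma word_le_take_drop u v i k : word_le u v ->
  word_le (take k (drop i u)) (take k (drop i v)).
Proof.
move=> uv.
have: word_le (drop i u) (drop i v).
  by elim: u v i uv => [|a u IH] [|b v] // [|i] //= /andP[_]; exact: IH.
move: (drop i u) (drop i v) => {uv} {}u {}v uv.
by elim: u v k uv => [|a u IH] [|b v] // [|k]//= /andP[-> uv] /=; exact: IH.
Qed.

Lemma update_mono k f : mono f -> mono (update k f).
Proof.
move=> mf u v uv; apply: expect_mono => //; [exact: distrs_rule..|].
by elim: (iota 0 k) => [|i s IH]; constructor => //; apply/rule_mono/word_le_take_drop.
Qed.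

Lemma eq_pca_mean t k f g x : (forall v, size v = k -> f v = g v) ->
  pca_mean t k f x = pca_mean t k g x.
Proof.
elim: t k f g => [|t IH] k f g fg /=; first by apply: fg; rewrite size_mkseq.
apply: IH => v _; apply: eq_expect => w; rewrite size_map size_iota; exact: fg.
Qed.

Lemma pca_mean_lin t k a f b g x : pca_mean t k (fun v => a * f v + b * g v) x =
  a * pca_mean t k f x + b * pca_mean t k g x.
Proof.
elim: t k f g => [//|t IH] k f g /=; rewrite -IH.
by apply: eq_pca_mean => v _; exact: expect_lin.
Qed.

Lemma pca_mean_cst t k c x : pca_mean t k (fun=> c) x = c.
Proof.
elim: t k => [//|t IH] k /=; rewrite -[RHS](IH (k + m)%N).
by apply: eq_pca_mean => v _; apply/expect_cst/distrs_rule.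
Qed.

Lemma pca_mean_le t k f g x : (forall v, size v = k -> f v <= g v) ->
  pca_mean t k f x <= pca_mean t k g x.
Proof.
elim: t k f g => [|t IH] k f g fg /=; first by apply: fg; rewrite size_mkseq.
apply: IH => v _; apply: expect_le; first exact: distrs_rule.
by move=> w; rewrite size_map size_iota; exact: fg.
Qed.

(** One step from all [Unknown] leads to a configuration that is above all
    [Unknown], and the later steps preserve this comparison. *)
Lemma start_mean_incr t k f : mono f -> start_mean t k f <= start_mean t.+1 k f.
Proof.
rewrite /start_mean; elim: t k f => [|t IH] k f mf; last exact/IH/update_mono.
rewrite [leLHS]/= [leRHS]/= /update.
set ps := map _ _; rewrite -[leLHS](@expect_cst ps); last exact: distrs_rule.
apply: expect_le; first exact: distrs_rule.
move=> v; rewrite size_map size_iota => sv; apply: mf.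
rewrite /mkseq; elim: v k {ps} sv => [|a v IH] [|k]//= [sv].
by rewrite -[X in iota X]addn0 iotaDl -map_comp; exact: IH.
Qed.

End Words.

(** * The limit of the averaged dynamics started from all unknown *)

Section Limit.
Variables (R : realType) (m : nat) (e0 e1 : R).
Hypotheses (e0_ge0 : 0 <= e0) (e1_ge0 : 0 <= e1) (e01_le1 : e0 + e1 <= 1).

Local Notation rule := (rule e0 e1).
Local Notation update := (update m e0 e1).
Local Notation pca_mean := (pca_mean m e0 e1).
Local Notation start_mean := (start_mean m e0 e1).

Lemma update_behead k f u :
  update k.+1 (fun v => f (behead v)) u = update k f (behead u).
Proof.
rewrite /update [iota 0 k.+1]/= [expect _ _]/= -!mulrDl rule_sum mul1r.
congr expect; rewrite (iotaDl 1 0) -map_comp; apply: eq_map => i /=.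
by rewrite add1n -drop1 drop_drop addn1.
Qed.

Lemma pca_mean_behead t k f x :
  pca_mean t k.+1 (fun v => f (behead v)) x = pca_mean t k f (x \o S).
Proof.
elim: t k f => [|t IH] k f /=.
  by congr f; rewrite /mkseq (iotaDl 1 0) -map_comp.
rewrite -IH addSn; apply: eq_pca_mean => // v _; exact: update_behead.
Qed.

Lemma update_take k f u : size u = (k + m).+1 ->
  update k.+1 (fun v => f (take k v)) u = update k f (take (k + m) u).
Proof.
move=> su; rewrite /update -[k.+1]addn1 iotaD map_cat expect_cat.
have -> : [seq rule (take m.+1 (drop i u)) | i <- iota 0 k] =
          [seq rule (take m.+1 (drop i (take (k + m) u))) | i <- iota 0 k].
  apply/eq_in_map => i; rewrite mem_iota add0n => /andP[_ ik].
  rewrite !take_drop take_takel; first by [].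
  by rewrite addSn -addnS addnC leq_add2r.
apply: eq_expect => v; rewrite size_map size_iota => sv.
by rewrite /= !take_size_cat// -!mulrDl rule_sum mul1r.
Qed.

Lemma pca_mean_take t k f x : pca_mean t k.+1 (fun v => f (take k v)) x = pca_mean t k f x.
Proof.
elim: t k f => [|t IH] k f /=.
  by rewrite /mkseq -map_take take_iota /minn ltnSn.
rewrite -[RHS]IH addSn; apply: eq_pca_mean => // v; exact: update_take.
Qed.

Lemma rule_rev w : rule (rev w) = rule w.
Proof. by apply/funext => b; rewrite /rule /open_value all_rev has_rev. Qed.

Lemma update_rev k f u : size u = (k + m)%N ->
  update k (fun v => f (rev v)) u = update k f (rev u).
Proof.
move=> su; rewrite /update -expect_rev; congr expect.
apply: (@eq_from_nth _ (rule [::])); first by rewrite size_rev !size_map.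
rewrite size_rev size_map size_iota => i ik.
rewrite nth_rev size_map size_iota// !(nth_map 0%N) ?size_iota//; last by lia.
rewrite !nth_iota//; last by lia.
rewrite !add0n drop_rev take_rev rule_rev; congr rule.
rewrite size_takel su; last by lia.
by rewrite take_drop; congr (drop _ (take _ _)); lia.
Qed.

Lemma start_mean_rev t k f : start_mean t k (fun v => f (rev v)) = start_mean t k f.
Proof.
rewrite /start_mean; elim: t k f => [|t IH] k f /=.
  have -> : mkseq (fun=> Unknown) k = nseq k Unknown.
    apply: (@eq_from_nth _ Unknown); rewrite size_mkseq ?size_nseq// => i ik.
    by rewrite nth_mkseq// nth_nseq ik.
  congr f; apply: (@eq_from_nth _ Unknown); rewrite size_rev size_nseq// => i ik.
  by rewrite nth_rev size_nseq// !nth_nseq ik; case: ifP.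
rewrite -[RHS]IH; apply: eq_pca_mean => // v; exact: update_rev.
Qed.

Lemma pca_mean_add t k f g x :
  pca_mean t k (fun v => f v + g v) x = pca_mean t k f x + pca_mean t k g x.
Proof.
rewrite -[pca_mean t k f x]mul1r -[pca_mean t k g x]mul1r -pca_mean_lin.
by apply: eq_pca_mean => // v _; rewrite !mul1r.
Qed.

Lemma word_bounded k (f : seq letter -> R) :
  exists2 M, 0 <= M & forall v, size v = k -> `|f v| <= M.
Proof.
elim: k f => [|k IH] f; first by exists `|f [::]| => // -[].
have [M0 M0p H0] := IH (fun v => f (Zero :: v)).
have [M1 M1p H1] := IH (fun v => f (One :: v)).
have [M2 M2p H2] := IH (fun v => f (Unknown :: v)).
exists (M0 + M1 + M2); first by rewrite !addr_ge0.
move=> [//|a v] [sv]; move: (H0 _ sv) (H1 _ sv) (H2 _ sv).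
by case: a => *; lra.
Qed.

Lemma letter_le_trans : transitive letter_le.
Proof. by case; case; case. Qed.

Lemma word_le_trans : transitive word_le.
Proof.
move=> v u w; elim: v u w => [|b v IH] [|a u] [|c w]//= /andP[ab uv] /andP[bc vw].
by rewrite (letter_le_trans ab bc) (IH u w).
Qed.

Lemma start_mean_mono_cvg k f : mono f -> cvgn (fun t => start_mean t k f).
Proof.
move=> mf; have [M _ HM] := word_bounded k f.
apply: nondecreasing_is_cvgn.
  by apply/nondecreasing_seqP => t; apply: start_mean_incr.
exists M => _ [t _ <-]; rewrite -(@pca_mean_cst _ m e0 e1 e0_ge0 e1_ge0 e01_le1 t k M (fun=> Unknown)).
apply: pca_mean_le => // v sv; apply: (le_trans (ler_norm _)); exact: HM.
Qed.

(** Functions that are an increasing event in the first letters times an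
    arbitrary function of the others: they interpolate between monotone
    functions and all functions, see [above_cvg]. *)
Definition above (p : seq letter) (g : seq letter -> R) (u : seq letter) : R :=
  (word_le p (take (size p) u))%:R * g (drop (size p) u).

(** Any function of one letter is a combination of the three increasing
    indicators of the letters above [Unknown], [Zero] and [One]. *)
Lemma above_rcons p g u : (size p < size u)%N ->
  above p g u =
  above (rcons p Unknown) (fun v => g (Unknown :: v)) u +
  above (rcons p Zero) (fun v => g (Zero :: v) - g (Unknown :: v)) u +
  above (rcons p One) (fun v => g (One :: v) - g (Unknown :: v)) u.
Proof.
move=> pu; set n := size p.
have [w [a [v [-> sw]]]] : exists w a v, u = w ++ a :: v /\ size w = n.
  exists (take n u), (nth Unknown u n), (drop n.+1 u); split.
    by rewrite -drop_nth// cat_take_drop.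
  by rewrite size_takel// ltnW.
have E b g' : above (rcons p b) g' (w ++ a :: v) =
  (word_le p w && letter_le b a)%:R * g' v.
  rewrite /above size_rcons -cat_rcons take_size_cat ?size_rcons ?sw//.
  rewrite drop_size_cat ?size_rcons ?sw//.
  rewrite -!cats1 /word_le; congr ((nat_of_bool _)%:R * _).
  move: (sw : size w = size p); clear; elim: p w => [|c p IH] [|d w]//= sw.
    by rewrite andbT.
  by rewrite -andbA IH//; case: sw.
rewrite !E /above -/n take_size_cat// drop_size_cat//.
by case: word_le; case: a {E} => /=; rewrite /letter_le /=; ring.
Qed.

(** Convergence for all functions follows from that for monotone ones by
    expanding the letters one at a time. *)
Lemma above_cvg j p g : cvgn (fun t => start_mean t (size p + j) (above p g)).
Proof.
elim: j p g => [|j IH] p g.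
  have -> : (fun t => start_mean t (size p + 0) (above p g)) =
    (fun t => start_mean t (size p) (above p (fun=> 1)) * g [::]).
    apply/funext => t; rewrite addn0 -[RHS]addr0 mulrC -[X in _ + X](mul0r (start_mean t (size p) (fun=> 0))).
    rewrite -pca_mean_lin; apply: eq_pca_mean => // v sv.
    by rewrite /above -sv drop_size mul0r addr0 mulr1 mulrC.
  apply: is_cvgMl; apply: start_mean_mono_cvg => u v uv; rewrite /above !mulr1.
  have := word_le_take_drop 0 (size p) uv; rewrite !drop0 => uv'.
  rewrite ler_nat; case: (boolP (word_le p _)) => // pu.
  by rewrite (word_le_trans pu uv').
have -> : (fun t => start_mean t (size p + j.+1) (above p g)) = (fun t =>
  start_mean t (size (rcons p Unknown) + j) (above (rcons p Unknown) (fun v => g (Unknown :: v))) +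
  start_mean t (size (rcons p Zero) + j) (above (rcons p Zero) (fun v => g (Zero :: v) - g (Unknown :: v))) +
  start_mean t (size (rcons p One) + j) (above (rcons p One) (fun v => g (One :: v) - g (Unknown :: v)))).
  apply/funext => t; rewrite !size_rcons addSnnS.
  rewrite /start_mean -!pca_mean_add; apply: eq_pca_mean => // v sv; apply: above_rcons.
  by rewrite sv; lia.
by do 2?apply: is_cvgD; exact: IH.
Qed.

Lemma start_mean_cvg k f : cvgn (fun t => start_mean t k f).
Proof.
have := @above_cvg k [::] f; rewrite /= add0n.
rewrite (_ : above [::] f = f)//; apply/funext => u.
by rewrite /above /= take0 drop0 mul1r.
Qed.

Definition limit_mean k f : R := limn (fun t => start_mean t k f).

Lemma limit_mean_cvg k f : (fun t => start_mean t k f) @ \oo --> limit_mean k f.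
Proof. exact: start_mean_cvg. Qed.

Lemma eq_limit_mean k f g : (forall v, size v = k -> f v = g v) ->
  limit_mean k f = limit_mean k g.
Proof.
by move=> fg; congr (limn _); apply/funext => t; apply: eq_pca_mean.
Qed.

Lemma limit_mean_lin k a f b g : limit_mean k (fun v => a * f v + b * g v) =
  a * limit_mean k f + b * limit_mean k g.
Proof.
apply: cvg_lim => //; rewrite /start_mean; under eq_fun do rewrite pca_mean_lin.
by apply: cvgD; apply: cvgMr; exact: limit_mean_cvg.
Qed.

Lemma limit_mean_cst k c : limit_mean k (fun=> c) = c.
Proof.
apply: cvg_lim => //; rewrite /start_mean; under eq_fun do rewrite pca_mean_cst//.
exact: cvg_cst.
Qed.

Lemma limit_mean_le k f g : (forall v, size v = k -> f v <= g v) ->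
  limit_mean k f <= limit_mean k g.
Proof.
move=> fg; apply: ler_lim; [exact: start_mean_cvg..|].
by apply: nearW => t; exact: pca_mean_le.
Qed.

(** Stationarity: the shifted sequence of averages has the same limit. *)
Lemma limit_mean_update k f : limit_mean k f = limit_mean (k + m) (update k f).
Proof.
apply: cvg_lim => //; rewrite -(cvg_shiftS (fun t => start_mean t k f)).
exact: limit_mean_cvg.
Qed.

Lemma limit_mean_behead k f : limit_mean k.+1 (fun v => f (behead v)) = limit_mean k f.
Proof.
by rewrite /limit_mean /start_mean; under eq_fun do rewrite pca_mean_behead.
Qed.

Lemma limit_mean_take k f : limit_mean k.+1 (fun v => f (take k v)) = limit_mean k f.
Proof. by rewrite /limit_mean /start_mean; under eq_fun do rewrite pca_mean_take. Qed.

Lemma limit_mean_rev k f : limit_mean k (fun v => f (rev v)) = limit_mean k f.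
Proof. by rewrite /limit_mean; under eq_fun do rewrite start_mean_rev. Qed.

End Limit.

(** * Frequencies of patterns in the limit law *)

Fixpoint words (k : nat) : seq (seq letter) :=
  if k is k'.+1 then
    flatten [seq [:: Zero :: w; One :: w; Unknown :: w] | w <- words k']
  else [:: [::]].

Lemma mem_words k u : size u = k -> u \in words k.
Proof.
elim: k u => [|k IH] [|a u]//= [su].
apply/flattenP; exists [:: Zero :: u; One :: u; Unknown :: u].
  by apply/mapP; exists u => //; exact: IH.
by case: a; rewrite !inE eqxx ?orbT.
Qed.

Lemma size_words k u : u \in words k -> size u = k.
Proof.
elim: k u => [|k IH] u /=; first by rewrite inE => /eqP->.
move=> /flattenP[_ /mapP[w /IH sw ->]].
by rewrite !inE => /or3P[]/eqP-> /=; rewrite sw.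
Qed.

Lemma words_all k (b : pred (seq letter)) : all b (words k) ->
  forall u, size u = k -> b u.
Proof. by move=> /allP H u su; apply/H/mem_words. Qed.

Section Events.
Variables (R : realType) (m : nat) (e0 e1 : R).
Hypotheses (e0_ge0 : 0 <= e0) (e1_ge0 : 0 <= e1) (e01_le1 : e0 + e1 <= 1).
Variable K : nat.

Local Notation r := (1 - e0 - e1).
Local Notation rule := (rule e0 e1).
Local Notation limit_mean := (limit_mean m e0 e1).

(** All events are events on windows of a fixed length [K], so that relations
    between their frequencies reduce to a computation over [words K]. *)
Definition pr (b : seq letter -> bool) := limit_mean K (fun u => (b u)%:R).

Definition starts (w u : seq letter) := take (size w) u == w.
Definition outcome (i : nat) (b : letter) (u : seq letter) :=
  open_value (take m.+1 (drop i u)) == b.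

Fixpoint pattern_prob (i : nat) (w u : seq letter) : R :=
  if w is b :: w' then
    (noise e0 e1 b + r * (outcome i b u)%:R) * pattern_prob i.+1 w' u
  else 1.

Lemma limit_mean_take_le k f : (k <= K)%N ->
  limit_mean K (fun u => f (take k u)) = limit_mean k f.
Proof.
move=> kK; rewrite -(subnK kK); elim: (K - k)%N => [|j IH].
  by apply: eq_limit_mean => v; rewrite add0n => <-; rewrite take_size.
rewrite -IH addSn -[RHS]limit_mean_take//; apply: eq_limit_mean => v sv.
by rewrite take_takel// leq_addl.
Qed.

Lemma expect_pattern u w i s : s = size w ->
  expect [seq rule (take m.+1 (drop j u)) | j <- iota i s]
    (fun v => (starts w v)%:R) = pattern_prob i w u.
Proof.
move=> ->{s}; elim: w i => [|b w IH] i //=.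
rewrite -IH {IH}.
set p := rule _; set ps := map _ _.
have E a : expect ps (fun v => (starts (b :: w) (a :: v))%:R) =
    (a == b)%:R * expect ps (fun v => (starts w v)%:R).
  rewrite -[_%:R * _]addr0 -[X in _ + X](mul0r (expect ps (fun=> 0))) -expect_lin.
  apply: eq_expect => v _; rewrite mul0r addr0 /starts/= eqseq_cons.
  by case: (a == b); rewrite ?mul1r ?mul0r.
rewrite !E /p /rule /outcome; case: b {E} => /=; ring.
Qed.

(** Stationarity, in the form in which it yields the balance equations. *)
Lemma pr_starts w : (size w + m <= K)%N ->
  pr (starts w) = limit_mean K (pattern_prob 0 w).
Proof.
move=> wK.
have -> : pr (starts w) = limit_mean (size w) (fun u => (starts w u)%:R).
  rewrite -(@limit_mean_take_le (size w)); last by lia.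
  by apply: eq_limit_mean => v _; rewrite /starts take_takel.
rewrite limit_mean_update// -(@limit_mean_take_le (size w + m))//.
apply: eq_limit_mean => u su; rewrite -(@expect_pattern u w 0 _ erefl) /update.
congr expect; apply/eq_in_map => i; rewrite mem_iota add0n => /andP[_ ik].
by rewrite !take_drop take_takel//; lia.
Qed.

Lemma pr_eq (b c : seq letter -> bool) : all (fun u => b u == c u) (words K) -> pr b = pr c.
Proof. by move=> /words_all H; apply: eq_limit_mean => u /H/eqP->. Qed.

Lemma pr_le (b c : seq letter -> bool) : all (fun u => b u ==> c u) (words K) -> pr b <= pr c.
Proof.
move=> /words_all H; apply: limit_mean_le => // u /H.
by rewrite ler_nat; case: (b u) => //= ->.
Qed.

Lemma pr_ge0 b : 0 <= pr b.
Proof.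
by rewrite -(@limit_mean_cst _ m e0 e1 e0_ge0 e1_ge0 e01_le1 K 0); apply: limit_mean_le.
Qed.

Lemma pr_split b c : pr b = pr (fun u => b u && c u) + pr (fun u => b u && ~~ c u).
Proof.
rewrite -[X in X + _]mul1r -[X in _ + X]mul1r -limit_mean_lin//.
by apply: eq_limit_mean => u _; case: (b u); case: (c u); rewrite /= ?mulr1 ?mulr0 ?addr0 ?add0r.
Qed.

Lemma pr_add (b c d : seq letter -> bool) : all (fun u => (b u + c u == d u)%N) (words K) ->
  pr b + pr c = pr d.
Proof.
move=> /words_all H; rewrite -[pr b]mul1r -[pr c]mul1r -limit_mean_lin//.
by apply: eq_limit_mean => u /H/eqP <-; rewrite !mul1r natrD.
Qed.

Lemma pr_le_add (b c d : seq letter -> bool) : all (fun u => (d u <= b u + c u)%N) (words K) ->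
  pr d <= pr b + pr c.
Proof.
move=> /words_all H; rewrite -[pr b]mul1r -[pr c]mul1r -limit_mean_lin//.
by apply: limit_mean_le => // u /H; rewrite !mul1r -natrD ler_nat.
Qed.

Lemma pr_add3 (b c d e : seq letter -> bool) : all (fun u => (b u + c u + d u == e u)%N) (words K) ->
  pr b + pr c + pr d = pr e.
Proof.
move=> /words_all H; rewrite -[pr b]mul1r -[pr c]mul1r -limit_mean_lin//.
rewrite -[limit_mean _ _]mul1r -[pr d]mul1r -limit_mean_lin//.
by apply: eq_limit_mean => u /H/eqP <-; rewrite !mul1r !natrD.
Qed.

(** Shift invariance: [b] must not look at the last letter of the window and
    [c] is [b] moved by one place to the left, so the same letters of a window
    of length [K.+1] decide both. *)
Lemma pr_shift (b c : seq letter -> bool) :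
  all (fun u => b (take K u) == c (behead u)) (words K.+1) -> pr b = pr c.
Proof.
move=> /words_all H; rewrite /pr -limit_mean_take// -[RHS]limit_mean_behead//.
by apply: eq_limit_mean => u /H/eqP->.
Qed.

Lemma pr_starts_take w : (size w <= K)%N ->
  pr (starts w) = limit_mean (size w) (fun u => (u == w)%:R).
Proof.
by move=> wK; rewrite -(@limit_mean_take_le (size w)).
Qed.

Lemma pr_starts_rev w : (size w <= K)%N -> pr (starts (rev w)) = pr (starts w).
Proof.
move=> wK; rewrite !pr_starts_take ?size_rev//.
rewrite -[RHS](@limit_mean_rev _ _ _ _ e0_ge0 e1_ge0 e01_le1).
by apply: eq_limit_mean => u _; rewrite (can2_eq revK revK).
Qed.

Lemma limit_mean_lin1 a (b : seq letter -> bool) : limit_mean K (fun u => a * (b u)%:R) = a * pr b.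
Proof.
rewrite -[RHS]addr0 -(mul0r (pr b)) -limit_mean_lin//.
by apply: eq_limit_mean => u _; rewrite mul0r addr0.
Qed.

Lemma limit_mean_lin2 a (b : seq letter -> bool) a' (b' : seq letter -> bool) :
  limit_mean K (fun u => a * (b u)%:R + a' * (b' u)%:R) = a * pr b + a' * pr b'.
Proof. by rewrite limit_mean_lin. Qed.

Lemma limit_mean_lin4 a a' c c' (b b' d d' : seq letter -> bool) :
  limit_mean K (fun u => (a * (b u)%:R + a' * (b' u)%:R) + (c * (d u)%:R + c' * (d' u)%:R))
  = (a * pr b + a' * pr b') + (c * pr d + c' * pr d').
Proof.
rewrite -!limit_mean_lin2 -[limit_mean _ _ in RHS]mul1r -[X in _ = _ + X]mul1r -limit_mean_lin//.
by apply: eq_limit_mean => u _; rewrite !mul1r.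
Qed.

End Events.

(** * Solving the balance equations *)

(** With q, A, B, C, D, T the frequencies of ?, ?0, ?1, ?01, 1?1, ?00, and G
    that of a pair on which the rule gives ? followed by the pair 00, the
    equations are those of [two_stationarity].  Eliminating A and C leaves a
    combination of q, B, D and 2 T - G with nonnegative coefficients that is
    equal to 0, and the coefficient [cq] of q is positive. *)
Lemma two_balance (R : realFieldType) (e0 e1 q A B C D T G : R) (r := 1 - e0 - e1) :
  0 <= e0 -> 0 <= e1 -> e0 + e1 <= 1 -> ~ (e0 = 0 /\ e1 = 0) ->
  0 <= q -> 0 <= B -> 0 <= D ->
  q = r * (q + A - B) -> A = e0 * q + r ^+ 2 * (B - D + C) ->
  B = e1 * q + r ^+ 2 * T -> C = e1 * A + r ^+ 2 * e0 * G -> G <= 2 * T ->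
  q = 0.
Proof.
move=> e0_ge0 e1_ge0 e01_le1 e_neq0 q_ge0 B_ge0 D_ge0.
have s_gt0 : 0 < e0 + e1.
  rewrite lt_neqAle addr_ge0// andbT; apply/eqP => /esym/eqP.
  by rewrite paddr_eq0// => /andP[/eqP ? /eqP ?]; apply: e_neq0.
have r_ge0 : 0 <= r by rewrite /r; lra.
have : r <= 1 by rewrite /r; lra.
have: e0 + e1 = 1 - r by rewrite /r; ring.
move: r r_ge0 => {}r r_ge0 sr r_le1 E1 E2 E3 E4 GT.
pose cq := (e0 + e1) - r * e0 - r ^+ 2 * e1 * (e0 + e1) + 2 * r ^+ 3 * e0 * e1.
pose cB := r * (1 - r ^+ 2 * (1 + e1 + 2 * e0)).
have key : q * cq + B * cB + r ^+ 3 * D + r ^+ 5 * e0 * (2 * T - G) = 0.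
  transitivity ((1 - r ^+ 2 * e1) * (q - r * (q + A - B)) +
    r * (A - (e0 * q + r ^+ 2 * (B - D + C))) + r ^+ 3 * (C - (e1 * A + r ^+ 2 * e0 * G))
    - 2 * r ^+ 3 * e0 * (B - (e1 * q + r ^+ 2 * T))).
    by rewrite /cq /cB sr; ring: sr.
  by rewrite -E1 -E2 -E3 -E4 !subrr !mulr0 !addr0 subr0.
have cq_gt0 : 0 < cq.
  have x3 : 0 <= r ^+ 3 * (e0 * e1) by rewrite mulr_ge0 ?exprn_ge0// mulr_ge0.
  have r2 : r ^+ 2 * (1 - r) <= 1 - r.
    by rewrite ler_piMl ?subr_ge0// exprn_ile1.
  have h1 : 0 <= e1 * (1 - r - r ^+ 2 * (1 - r)) by rewrite mulr_ge0// subr_ge0.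
  have h2 : 0 <= e1 * r by rewrite mulr_ge0.
  have h3 : 0 < (e0 + e1) * (e0 + e1) by rewrite mulr_gt0.
  rewrite /cq sr; nra.
have cB_ge0 : 0 <= cB.
  rewrite mulr_ge0// subr_ge0.
  apply: (@le_trans _ _ (r ^+ 2 * (1 + 2 * (1 - r)))).
    by rewrite ler_wpM2l ?exprn_ge0// -sr; lra.
  have : 0 <= (1 - r) ^+ 2 * (1 + 2 * r) by rewrite mulr_ge0 ?sqr_ge0//; lra.
  lra.
have : q * cq <= 0.
  have := mulr_ge0 B_ge0 cB_ge0.
  have := mulr_ge0 (exprn_ge0 3 r_ge0) D_ge0.
  have : 0 <= r ^+ 5 * e0 * (2 * T - G).
    by rewrite !mulr_ge0 ?exprn_ge0// subr_ge0.
  lra.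
rewrite pmulr_lle0// => q_le0.
by apply/eqP; rewrite eq_le q_le0.
Qed.

(** The condition under which the linear form (1 + e) T + 2 e K of
    [three_balance] is largest at K = T, given the bound on tau T + kap K. *)
Lemma three_zero_run_bound (R : realFieldType) (e r : R) :
  0 <= e -> e <= 2^-1 -> 0 <= r -> r <= 1 - e ->
  (1 + e) * (r ^+ 2 * (r + e + e)) <=
  2 * (1 - e ^+ 2 * r ^+ 2 - e * r ^+ 2 * (r + e + e)).
Proof.
move=> e_ge0 e_half r_ge0 re; have e1_ge0 : 0 <= 1 - e by lra.
have r2e : r ^+ 2 <= (1 - e) ^+ 2 by rewrite lerXn2r ?nnegrE//; lra.
have h1 : (1 + e) * (r ^+ 2 * (r + e + e)) <= 1.
  apply: (@le_trans _ _ ((1 + e) * ((1 - e) ^+ 2 * (1 + e)))).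
    rewrite ler_wpM2l//; first by lra.
    by apply: ler_pM => //; [exact: exprn_ge0|lra|lra].
  rewrite (_ : (1 + e) * _ = ((1 + e) * (1 - e)) ^+ 2); last by ring.
  rewrite exprn_ile1//; last by have := sqr_ge0 e; clear; lra.
  by rewrite mulr_ge0//; lra.
apply: (le_trans h1); rewrite {h1}.
have h1 : e * (r + e) ^+ 3 <= 2^-1.
  by rewrite -[leRHS]mulr1 ler_pM// ?exprn_ge0// ?exprn_ile1//; lra.
have h2 : 0 <= e ^+ 3 * (e + 3 * r) by rewrite mulr_ge0 ?exprn_ge0// addr_ge0// mulr_ge0.
rewrite (_ : _ - _ - _ = 1 - e * (r + e) ^+ 3 + e ^+ 3 * (e + 3 * r)); last by ring.
clear -h1 h2; lra.
Qed.

(** It is enough to look at s = e, where the difference of the two sides is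
    at least e ^ 3 (1 - e) (3 - e). *)
Lemma three_last_one_bound (R : realFieldType) (e r : R) (s := 1 - r) :
  0 <= e -> e <= 2^-1 -> 0 <= r -> r <= 1 - e ->
  r ^+ 2 * e * (1 + 3 * e) <= (1 - e ^+ 2 * r ^+ 2) * (s + s ^+ 2 - s ^+ 3).
Proof.
move=> e_ge0 e_half r_ge0 re; have e1_ge0 : 0 <= 1 - e by lra.
have r2e : r ^+ 2 <= (1 - e) ^+ 2 by rewrite lerXn2r ?nnegrE//; lra.
have es : e <= s by rewrite /s; lra.
have s1 : s <= 1 by rewrite /s; lra.
have s0 : 0 <= s by lra.
have e_le1 : e <= 1 by lra.
have h1 : e + e ^+ 2 - e ^+ 3 <= s + s ^+ 2 - s ^+ 3.
  rewrite -subr_ge0 (_ : _ - _ = (s - e) * ((1 - s * e) + s * (1 - s) + e * (1 - e))); last by ring.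
  apply: mulr_ge0; first by rewrite subr_ge0.
  have se : 0 <= 1 - s * e by rewrite subr_ge0 mulr_ile1.
  have ss : 0 <= s * (1 - s) by rewrite mulr_ge0// subr_ge0.
  have ee : 0 <= e * (1 - e) by rewrite mulr_ge0.
  exact: addr_ge0 (addr_ge0 se ss) ee.
have e2r2 : e ^+ 2 * r ^+ 2 <= e ^+ 2.
  by rewrite ler_piMr ?exprn_ge0// exprn_ile1//; lra.
apply: (@le_trans _ _ ((1 - e ^+ 2) * (e + e ^+ 2 - e ^+ 3))); last first.
  have e32 : e ^+ 3 <= e ^+ 2 by rewrite exprS ler_piMl ?exprn_ge0.
  have e2 : e ^+ 2 <= 1 by rewrite exprn_ile1.
  by apply: ler_pM => //; move: e_ge0 e32 e2 e2r2; clear; lra.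
apply: (@le_trans _ _ ((1 - e) ^+ 2 * (e * (1 + 3 * e)))).
  by rewrite -mulrA ler_wpM2r// mulr_ge0// addr_ge0// mulr_ge0.
rewrite -subr_ge0 (_ : _ - _ = e ^+ 3 * ((1 - e) * (3 - e))); last by ring.
by rewrite mulr_ge0 ?exprn_ge0// mulr_ge0//; lra.
Qed.

(** The noise imposing three zeros in a row feeds a part of q of order e ^ 3
    back into T; this says that it does not compensate the loss of q. *)
Lemma three_unknown_bound (R : realFieldType) (e r : R) :
  0 <= e -> e <= 2^-1 -> 0 <= r -> r <= 1 - e ->
  2 * r ^+ 3 * e ^+ 4 * (1 + 3 * e) <= e ^+ 3 * (3 / 5).
Proof.
move=> e_ge0 e_half r_ge0 re; have e1_ge0 : 0 <= 1 - e by lra.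
have r2e : r ^+ 2 <= (1 - e) ^+ 2 by rewrite lerXn2r ?nnegrE//; lra.
rewrite (_ : _ * (1 + 3 * e) = e ^+ 3 * (2 * (r ^+ 3 * (e * (1 + 3 * e))))); last by ring.
rewrite ler_wpM2l ?exprn_ge0//.
have q0 : 0 <= e * (1 + 3 * e) by rewrite mulr_ge0// addr_ge0// mulr_ge0.
apply: (@le_trans _ _ (2 * ((1 - e) ^+ 3 * (e * (1 + 3 * e))))).
  by rewrite ler_wpM2l// ler_wpM2r// lerXn2r ?nnegrE.
rewrite (_ : (1 - e) ^+ 3 * _ = (e * (1 - e)) * ((1 - e) ^+ 2 * (1 + 3 * e))); last by ring.
have h' : e * (1 - e) <= 4^-1 by have := sqr_ge0 (e - 2^-1); clear; lra.
have h : (1 - e) ^+ 2 * (1 + 3 * e) <= 6 / 5.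
  have := sqr_ge0 (7 * e - 1).
  have : e * (1 - e) >= 0 by rewrite mulr_ge0.
  have : 0 <= e ^+ 2 * (1 - 2 * e) by rewrite mulr_ge0 ?exprn_ge0//; lra.
  clear; lra.
have : (e * (1 - e)) * ((1 - e) ^+ 2 * (1 + 3 * e)) <= 4^-1 * (6 / 5).
  apply: ler_pM => //; first exact: mulr_ge0.
  by rewrite mulr_ge0 ?exprn_ge0//; lra.
clear; lra.
Qed.

(** Here e and d are the probabilities of an imposed 0 and 1, and q, A, Z, F,
    T, W are the frequencies of ?, ?0, ?0?, ?001, ?000, ?00; U, V1, V2, V3 are
    those of an undetermined window of three letters (one on which the rule
    gives ?), alone and with the first 1 after it coming at distance 1, 2, 3; Y and N are those of an undetermined
    window followed by a window 000 starting at distance 2 and 3; Rr, K, M are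
    the frequencies of ?0001, ?0000 and ?00000.

    The weight inequality, written in terms of q, V1, T and K only, is [main]:
    it bounds q and V1 by T and K.  The equation for T bounds T and K by V1 and
    q in turn ([Tle]).  Composing both gives a coefficient for V1 that is
    nonnegative and one for q that is positive; for d = 0 both are of order
    e ^ 3, so that all terms up to that order have to be kept. *)
Lemma three_balance (R : realFieldType)
  (e d q A F Z T U V1 V2 V3 Y N Rr K M W : R) (r := 1 - e - d) :
  0 <= e -> 0 <= d -> e + d <= 1 -> ~ (e = 0 /\ d = 0) -> e <= 2^-1 ->
  0 <= q -> 0 <= T -> 0 <= V1 -> 0 <= K -> 0 <= A -> 0 <= Rr ->
  q = r * U -> A = e * q + r ^+ 2 * V1 ->
  Z = r ^+ 2 * e * (U - V1 - V2 - Y) ->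
  F = d * W + r ^+ 2 * e ^+ 2 * N -> W <= A ->
  T = r * ((1 - d) ^+ 3 * V1 + e * (1 - d) ^+ 2 * V2 + e ^+ 2 * (1 - d) * V3
           + e ^+ 3 * (U - V1 - V2 - V3)) ->
  U + 2 * V1 <= q + 2 * A + 2 * F - Z ->
  V2 <= V1 + Rr -> Y <= T + K -> N <= T + K + M -> M <= K -> Rr + K <= T -> V3 <= V1 + T ->
  q = 0.
Proof.
move=> e_ge0 d_ge0 ed_le1 ed_neq0 e_half q_ge0 T_ge0 V1_ge0 K_ge0 A_ge0 Rr_ge0.
have s_gt0 : 0 < e + d.
  rewrite lt_neqAle addr_ge0// andbT; apply/eqP => /esym/eqP.
  by rewrite paddr_eq0// => /andP[/eqP ? /eqP ?]; apply: ed_neq0.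
have r_ge0 : 0 <= r by rewrite /r; lra.
have : r <= 1 by rewrite /r; lra.
have: d = 1 - r - e by rewrite /r; ring.
move: r r_ge0 => {}r r_ge0 dE r_le1 qU AE ZE FE WA TE bal V2_le Y_le N_le M_le RK V3_le.
have [r0|r_gt0] := eqVneq r 0; first by rewrite qU r0 mul0r.
have {}r_gt0 : 0 < r by rewrite lt_neqAle eq_sym r_gt0.
pose c := 1 - d.
have cE : c = r + e by rewrite /c dE; ring.
have ce : 0 <= c by rewrite cE addr_ge0.
have c1 : c <= 1 by rewrite /c; lra.
have rle : r <= 1 - e by lra.
have e2r2 : e ^+ 2 * r ^+ 2 <= e ^+ 2.
  by rewrite ler_piMr ?exprn_ge0// exprn_ile1.
have e_le1 : e <= 1 by lra.
have e2 : e ^+ 2 <= e by rewrite expr2 ler_piMl.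
have X_ge0 : 0 <= (1 + e) * T + 2 * e * K.
  by rewrite addr_ge0// !mulr_ge0// addr_ge0.
pose al := d * (1 - e) ^+ 2 + e ^+ 3 + 3 * e ^+ 2 * d + 3 * e * d ^+ 2.
pose s := e + d.
have main : al * q + r * (2 * V1 * (s + s ^+ 2 - s ^+ 3)) <=
   r * (2 * r ^+ 2 * e * ((1 + e) * T + 2 * e * K)).
  have h1 : d * W <= d * A by rewrite ler_wpM2l.
  have h2 : r ^+ 2 * e ^+ 2 * N <= r ^+ 2 * e ^+ 2 * (T + 2 * K).
    by rewrite ler_wpM2l ?mulr_ge0 ?exprn_ge0//; move: N_le M_le; clear; lra.
  have h3 : r ^+ 2 * e * (U - 2 * V1 - 2 * T) <= Z.
    by rewrite ZE ler_wpM2l ?mulr_ge0 ?exprn_ge0//; move: V2_le Y_le RK; clear; lra.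
  have : U + 2 * V1 <= q + 2 * (1 + d) * A + 2 * (r ^+ 2 * e ^+ 2 * (T + 2 * K))
     - r ^+ 2 * e * (U - 2 * V1 - 2 * T).
    by move: bal FE h1 h2 h3; clear; lra.
  move=> /(ler_wpM2l r_ge0).
  rewrite /al /s AE qU dE -subr_ge0 => h4; rewrite -subr_ge0.
  by apply: le_trans h4 _; rewrite le_eqVlt; apply/orP; left; apply/eqP; ring.
pose kap := e * r ^+ 2 * (c + e).
have kap_ge0 : 0 <= kap by apply: mulr_ge0; [apply: mulr_ge0; rewrite ?exprn_ge0|exact: addr_ge0].
pose tau := 1 - e ^+ 2 * r ^+ 2 - kap.
pose gam := r * (c ^+ 3 - e ^+ 3) + kap + e ^+ 2 * r ^+ 2.
have Tle : tau * T + kap * K <= gam * V1 + e ^+ 3 * q.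
  have h1 : kap * V2 <= kap * (V1 + T - K).
    by rewrite ler_wpM2l//; move: V2_le RK; clear; lra.
  have h2 : e ^+ 2 * r ^+ 2 * V3 <= e ^+ 2 * r ^+ 2 * (V1 + T).
    by rewrite ler_wpM2l ?mulr_ge0 ?exprn_ge0.
  have : T = r * (c ^+ 3 - e ^+ 3) * V1 + kap * V2 + e ^+ 2 * r ^+ 2 * V3 + e ^+ 3 * q.
    by rewrite {1}TE -/c qU /kap cE; ring.
  rewrite /tau /gam; move: h1 h2; clear; lra.
have gam1 : gam <= 1.
  have -> : gam = c ^+ 4 - e ^+ 3 * (e + 4 * r) by rewrite /gam /kap cE; ring.
  have : c ^+ 4 <= 1 by rewrite exprn_ile1.
  have : 0 <= e ^+ 3 * (e + 4 * r) by rewrite mulr_ge0 ?exprn_ge0// addr_ge0// mulr_ge0.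
  clear; lra.
have comb : (1 - e ^+ 2 * r ^+ 2) * ((1 + e) * T + 2 * e * K) <=
    (1 + 3 * e) * (tau * T + kap * K).
  rewrite -subr_ge0.
  have -> : (1 + 3 * e) * (tau * T + kap * K) -
    (1 - e ^+ 2 * r ^+ 2) * ((1 + e) * T + 2 * e * K) =
    e * (2 * tau - (1 + e) * (r ^+ 2 * (r + e + e))) * (T - K).
    by rewrite /tau /kap cE; ring.
  apply: mulr_ge0; last by move: RK Rr_ge0; clear; lra.
  by apply: mulr_ge0 => //; rewrite subr_ge0 /tau /kap cE; exact: three_zero_run_bound.
have sr : s = 1 - r by rewrite /s dE; ring.
have sig : r ^+ 2 * e * (1 + 3 * e) <= (1 - e ^+ 2 * r ^+ 2) * (s + s ^+ 2 - s ^+ 3).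
  by rewrite sr; exact: three_last_one_bound.
have qpos : 0 < (1 - e ^+ 2 * r ^+ 2) * al - 2 * r ^+ 3 * e ^+ 4 * (1 + 3 * e).
  have al_ge : e ^+ 3 + d * (1 - e) ^+ 2 <= al.
    have h : 0 <= e ^+ 2 * d by rewrite mulr_ge0 ?exprn_ge0.
    have h' : 0 <= e * d ^+ 2 by rewrite mulr_ge0 ?exprn_ge0.
    rewrite /al; move: h h'; clear; lra.
  have e34 : 3 / 4 <= 1 - e ^+ 2 * r ^+ 2.
    have : e ^+ 2 <= 2^-1 ^+ 2 by rewrite lerXn2r ?nnegrE ?invr_ge0.
    move: e2r2; clear; lra.
  have h3 := three_unknown_bound e_ge0 e_half r_ge0 rle.
  have e3 : 0 <= e ^+ 3 by rewrite exprn_ge0.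
  have de : 0 <= d * (1 - e) ^+ 2 by rewrite mulr_ge0 ?sqr_ge0.
  have al_ge0 : 0 <= al by rewrite (le_trans _ al_ge)// addr_ge0.
  have h4 : 3 / 4 * al <= (1 - e ^+ 2 * r ^+ 2) * al by rewrite ler_wpM2r.
  have h5 : 0 < e ^+ 3 + d * (1 - e) ^+ 2.
    have [e_gt0|e_le0] := ltP 0 e.
      by rewrite ltr_wpDr// exprn_gt0.
    have e0 : e = 0 by apply/eqP; rewrite eq_le e_le0.
    by move: s_gt0; rewrite e0 expr0n /= !add0r subr0 expr1n mulr1.
  move: h3 h4 h5 al_ge de e3; clear; lra.
have fin : ((1 - e ^+ 2 * r ^+ 2) * al - 2 * r ^+ 3 * e ^+ 4 * (1 + 3 * e)) * q <= 0.
  have er : 0 <= 1 - e ^+ 2 * r ^+ 2.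
    by rewrite subr_ge0 (le_trans e2r2)// exprn_ile1.
  have m1 := ler_wpM2l er main.
  have m2 : 2 * r ^+ 3 * e * ((1 - e ^+ 2 * r ^+ 2) * ((1 + e) * T + 2 * e * K)) <=
     2 * r ^+ 3 * e * ((1 + 3 * e) * (V1 + e ^+ 3 * q)).
    rewrite ler_wpM2l ?mulr_ge0 ?exprn_ge0//; apply: (le_trans comb).
    rewrite ler_wpM2l ?addr_ge0 ?mulr_ge0//; apply: (le_trans Tle).
    by rewrite lerD2r ler_piMl.
  have m3 : 2 * r * V1 * (r ^+ 2 * e * (1 + 3 * e)) <=
     2 * r * V1 * ((1 - e ^+ 2 * r ^+ 2) * (s + s ^+ 2 - s ^+ 3)).
    by rewrite ler_wpM2l ?mulr_ge0.
  move: m1 m2 m3; clear; lra.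
by apply/eqP; rewrite eq_le q_ge0 andbT; rewrite pmulr_rle0// in fin.
Qed.

(** * Unknown letters disappear in the limit law *)

Section Two.
Variables (R : realType) (e0 e1 : R).
Hypotheses (e0_ge0 : 0 <= e0) (e1_ge0 : 0 <= e1) (e01_le1 : e0 + e1 <= 1).
Local Notation r := (1 - e0 - e1).
Local Notation pr := (pr 1 e0 e1 4).
Local Notation und i := (outcome 1 i Unknown).
Local Notation has1 i := (outcome 1 i Zero).
Local Notation all0 i := (outcome 1 i One).

(** Patterns of the previous row that produce the given ones.  The first
    equation uses reflection: 0? is as frequent as ?0. *)
Lemma two_stationarity (q := pr (starts [:: Unknown]))
    (A := pr (starts [:: Unknown; Zero])) (B := pr (starts [:: Unknown; One]))
    (C := pr (starts [:: Unknown; Zero; One])) (D := pr (starts [:: One; Unknown; One]))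
    (T := pr (starts [:: Unknown; Zero; Zero])) (G := pr (fun u => und 0 u && all0 2 u)) :
  [/\ q = r * (q + A - B), A = e0 * q + r ^+ 2 * (B - D + C),
      B = e1 * q + r ^+ 2 * T, C = e1 * A + r ^+ 2 * e0 * G & G <= 2 * T].
Proof.
pose V := pr (fun u => und 0 u && has1 1 u).
have qU : q = r * pr (und 0).
  rewrite /q pr_starts// -limit_mean_lin1//; apply: eq_limit_mean => u _ /=.
  by rewrite add0r mulr1.
have U : pr (und 0) = q + A - B.
  have h1 : q + pr (starts [:: Zero; Unknown]) = pr (und 0) + B.
    pose W := pr (fun u => starts [:: Unknown] u && und 0 u).
    have h2 : W + B = q by apply: pr_add => //; vm_compute.
    have h3 : W + pr (starts [:: Zero; Unknown]) = pr (und 0).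
      by apply: pr_add => //; vm_compute.
    by rewrite -h2 -h3; ring.
  have h2 : pr (starts [:: Zero; Unknown]) = A by rewrite -pr_starts_rev.
  by rewrite -h2 h1 addrK.
have AE : A = e0 * q + r ^+ 2 * V.
  rewrite qU mulrA /A pr_starts// -limit_mean_lin2//; apply: eq_limit_mean => u _ /=.
  case: (outcome _ 0 _ _) => /=; case: (outcome _ 1 _ _) => /=; ring.
have VE : V = B - D + C.
  have h1 : pr (fun u => starts [:: Unknown; One] (behead u) && (nth Unknown u 0 != One)) + C = V.
    by apply: pr_add => //; vm_compute.
  have h2 : pr (fun u => starts [:: Unknown; One] (behead u) && (nth Unknown u 0 != One)) + D = B.
    have -> : B = pr (fun u => starts [:: Unknown; One] (behead u)).
      by symmetry; apply: pr_shift => //; vm_compute.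
    by apply: pr_add => //; vm_compute.
  by rewrite -h1 -h2; ring.
have BE : B = e1 * q + r ^+ 2 * T.
  rewrite qU mulrA.
  have -> : T = pr (fun u => und 0 u && all0 1 u).
    by apply: pr_eq => //; vm_compute.
  rewrite /B pr_starts// -limit_mean_lin2//; apply: eq_limit_mean => u _ /=.
  case: (outcome _ 0 _ _) => /=; case: (outcome _ 1 _ _) => /=; ring.
have CE : C = e1 * A + r ^+ 2 * e0 * G.
  have disj : forall u, size u = 4%N -> ~~ [&& has1 1 u, all0 2 u & und 0 u].
    by apply: words_all; vm_compute.
  rewrite /A /C !pr_starts// -limit_mean_lin//; apply: eq_limit_mean => u /disj /=.
  case: (outcome _ 0 _ _) => /=; case: (outcome _ 1 _ _) => /=;
    case: (outcome _ 2 _ _) => //= _; ring.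
have GT : G <= 2 * T.
  rewrite -[2%:R]/(1 + 1) mulrDl mul1r.
  have {2}-> : T = pr (fun u => starts [:: Unknown; Zero; Zero] (behead u)).
    by symmetry; apply: pr_shift => //; vm_compute.
  by apply: pr_le_add => //; vm_compute.
by split => //; rewrite -?VE -?U.
Qed.

Lemma two_unknown_vanishes : ~ (e0 = 0 /\ e1 = 0) -> pr (starts [:: Unknown]) = 0.
Proof.
move=> e_neq0; have [E1 E2 E3 E4 GT] := two_stationarity.
by apply: (two_balance e0_ge0 e1_ge0 e01_le1 e_neq0 _ _ _ E1 E2 E3 E4 GT);
  exact: pr_ge0.
Qed.
End Two.

Section Three.
Variables (R : realType) (e0 e1 : R).
Hypotheses (e0_ge0 : 0 <= e0) (e1_ge0 : 0 <= e1) (e01_le1 : e0 + e1 <= 1).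
Local Notation r := (1 - e0 - e1).
Local Notation pr := (pr 2 e0 e1 6).
Local Notation und i := (outcome 2 i Unknown).
Local Notation has1 i := (outcome 2 i Zero).
Local Notation all0 i := (outcome 2 i One).

(** The weight q + 2 A + 2 F - Z does not increase under the noiseless rule:
    the left-hand side is the weight of the image.  Both sides are split
    according to the letters next to a ?, and the difference is found to be
    the frequency of 1?1 plus two further nonnegative terms.  Reflection turns
    00? into ?00 and 0? into ?0. *)
Lemma three_weight_loss (q := pr (starts [:: Unknown]))
    (A := pr (starts [:: Unknown; Zero])) (Z := pr (starts [:: Unknown; Zero; Unknown]))
    (F := pr (starts [:: Unknown; Zero; Zero; One])) :
  pr (und 0) + 2 * pr (fun u => und 0 u && has1 1 u) <= q + 2 * A + 2 * F - Z.
Proof.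
pose B := pr (starts [:: Unknown; One]).
pose W := pr (starts [:: Unknown; Zero; Zero]).
pose S := pr (starts [:: Unknown; Zero; One]).
pose P0 := pr (starts [:: Zero; Unknown; One]).
pose P1 := pr (starts [:: One; Unknown; One]).
pose PQ := pr (starts [:: Unknown; Unknown; One]).
pose X1 := pr (fun u => starts [:: Unknown] u && und 0 u).
pose X2 := pr (fun u => starts [:: Zero; Unknown] u && und 0 u).
have U1 : X1 + X2 + W = pr (und 0).
  rewrite /W -pr_starts_rev//; apply: pr_add3 => //; vm_compute; reflexivity.
have U2 : X1 + B + (S + PQ) = q.
  have -> : S + PQ = pr (fun u => [&& starts [:: Unknown] u,
      nth Unknown u 1 != One & nth Unknown u 2 == One]).
    by apply: pr_add => //; vm_compute.
  by apply: pr_add3 => //; vm_compute.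
have U3 : X2 + P0 = A.
  rewrite /A -pr_starts_rev//; apply: pr_add => //; vm_compute; reflexivity.
have AE : Z + S + W = A by apply: pr_add3 => //; vm_compute.
have BE : P0 + PQ + P1 = B.
  have -> : B = pr (fun u => starts [:: Unknown; One] (behead u)).
    by symmetry; apply: pr_shift => //; vm_compute.
  by apply: pr_add3 => //; vm_compute.
pose v1 := pr (fun u => [&& nth Unknown u 0 != One, nth Unknown u 1 != One,
   nth Unknown u 2 == Unknown & nth Unknown u 3 == One]).
pose v2 := pr (fun u => [&& nth Unknown u 0 != One & starts [:: Unknown; Zero; One] (behead u)]).
have V1 : v1 + v2 + F = pr (fun u => und 0 u && has1 1 u).
  by apply: pr_add3 => //; vm_compute.
have V2 : v1 + P1 <= B.
  have -> : P1 = pr (fun u => starts [:: One; Unknown; One] (behead u)).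
    by symmetry; apply: pr_shift => //; vm_compute.
  have -> : B = pr (fun u => starts [:: Unknown; One] (behead u)).
    by symmetry; apply: pr_shift => //; vm_compute.
  have -> : pr (fun u => starts [:: Unknown; One] (behead u)) =
      pr (fun u => starts [:: Unknown; One] (behead (behead u))).
    by symmetry; apply: pr_shift => //; vm_compute.
  rewrite [leRHS](pr_split _ e0_ge0 e1_ge0 e01_le1 _ _ (fun u => nth Unknown u 1 == One)).
  rewrite addrC lerD//; apply: pr_le => //; vm_compute; reflexivity.
have V3 : v2 <= S.
  have -> : S = pr (fun u => starts [:: Unknown; Zero; One] (behead u)).
    by symmetry; apply: pr_shift => //; vm_compute.
  by apply: pr_le => //; vm_compute.
have P1_ge0 : 0 <= P1 by exact: pr_ge0.
rewrite -V1 -U1.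
move: U2 U3 AE BE V2 V3 P1_ge0; clear.
move: X1 X2 W S PQ B P0 P1 v1 v2 => X1 X2 W S PQ B P0 P1 v1 v2.
lra.
Qed.

(** The equations needed by [three_balance].  In the window of the second, third
    or fourth letter of a pattern that starts with an undetermined window, a 1
    can only sit to the right of that undetermined window, which makes the
    events [has1 i] increase with [i]. *)
Lemma three_unknown_vanishes : ~ (e0 = 0 /\ e1 = 0) -> e0 <= 2^-1 ->
  pr (starts [:: Unknown]) = 0.
Proof.
move=> e_neq0 e0_half; have bal := three_weight_loss.
pose V1 := pr (fun u => und 0 u && has1 1 u).
pose V2 := pr (fun u => [&& und 0 u, ~~ has1 1 u & has1 2 u]).
pose V3 := pr (fun u => [&& und 0 u, ~~ has1 2 u & has1 3 u]).
pose V4 := pr (fun u => und 0 u && ~~ has1 3 u).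
pose Y := pr (fun u => und 0 u && all0 2 u).
pose N := pr (fun u => und 0 u && all0 3 u).
pose P := pr (fun u => und 0 u && und 2 u).
pose T := pr (starts [:: Unknown; Zero; Zero; Zero]).
pose T1 := pr (starts [:: Unknown; Zero; Zero; Zero; One]).
pose T0 := pr (starts [:: Unknown; Zero; Zero; Zero; Zero]).
pose T00 := pr (starts [:: Unknown; Zero; Zero; Zero; Zero; Zero]).
have has1_12 : forall u, size u = 6%N -> und 0 u && has1 1 u ==> has1 2 u.
  by apply: words_all; vm_compute.
have has1_23 : forall u, size u = 6%N -> und 0 u && has1 2 u ==> has1 3 u.
  by apply: words_all; vm_compute.
have disj0 : forall u, size u = 6%N -> ~~ [&& und 0 u, has1 1 u & und 2 u].
  by apply: words_all; vm_compute.
have disj1 : forall u, size u = 6%N -> ~~ [&& und 0 u, has1 1 u & all0 3 u].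
  by apply: words_all; vm_compute.
have disj2 : forall u, size u = 6%N -> ~~ [&& und 0 u, has1 2 u & all0 3 u].
  by apply: words_all; vm_compute.
have U4 : V1 + V2 + Y + P = pr (und 0).
  pose h := pr (fun u => und 0 u && has1 2 u).
  have h1 : V1 + V2 = h by apply: pr_add => //; vm_compute.
  by rewrite h1; apply: pr_add3 => //; vm_compute.
have U3 : V1 + V2 + V3 + V4 = pr (und 0).
  pose h := pr (fun u => und 0 u && has1 2 u).
  have h1 : V1 + V2 = h by apply: pr_add => //; vm_compute.
  by rewrite h1; apply: pr_add3 => //; vm_compute.
have qU : pr (starts [:: Unknown]) = r * pr (und 0).
  rewrite pr_starts// -limit_mean_lin1//; apply: eq_limit_mean => u _ /=.
  by rewrite add0r mulr1.
have AE : pr (starts [:: Unknown; Zero]) = e0 * pr (starts [:: Unknown]) + r ^+ 2 * V1.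
  rewrite qU mulrA pr_starts// -limit_mean_lin2//; apply: eq_limit_mean => u _ /=.
  case: (outcome _ 0 _ _) => /=; case: (outcome _ 1 _ _) => /=; ring.
have ZE : pr (starts [:: Unknown; Zero; Unknown]) = r ^+ 2 * e0 * (pr (und 0) - V1 - V2 - Y).
  have -> : pr (und 0) - V1 - V2 - Y = P by rewrite -U4; ring.
  rewrite pr_starts// -limit_mean_lin1//; apply: eq_limit_mean => u su /=.
  move: (disj0 _ su); case: (outcome _ 0 _ _) => /=; case: (outcome _ 1 _ _) => /=;
    case: (outcome _ 2 _ _) => //= _; ring.
have FE : pr (starts [:: Unknown; Zero; Zero; One]) =
    e1 * pr (starts [:: Unknown; Zero; Zero]) + r ^+ 2 * e0 ^+ 2 * N.
  rewrite !pr_starts// -limit_mean_lin//; apply: eq_limit_mean => u su /=.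
  move: (disj1 _ su) (disj2 _ su); case: (outcome _ 0 _ _) => /=; case: (outcome _ 1 _ _) => /=;
    case: (outcome _ 2 _ _) => //=; case: (outcome _ 3 _ _) => //= _ _; ring.
have TE : T = r * ((1 - e1) ^+ 3 * V1 + e0 * (1 - e1) ^+ 2 * V2 + e0 ^+ 2 * (1 - e1) * V3
           + e0 ^+ 3 * (pr (und 0) - V1 - V2 - V3)).
  have -> : pr (und 0) - V1 - V2 - V3 = V4 by rewrite -U3; ring.
  rewrite -[X in r * X]addrA -limit_mean_lin4// -[RHS]addr0 -(mul0r (pr (und 0))) -limit_mean_lin//.
  rewrite /T pr_starts//; apply: eq_limit_mean => u su /=.
  move: (has1_12 _ su) (has1_23 _ su).
  case: (outcome _ 0 _ _) => /=; case: (outcome _ 1 _ _) => /=;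
    case: (outcome _ 2 _ _) => //=; case: (outcome _ 3 _ _) => //= _ _; ring.
have und1 : pr (fun u => und 1 u && has1 2 u) = V1.
  by apply: pr_shift => //; vm_compute.
have und2 : pr (fun u => und 2 u && has1 3 u) = V1.
  by rewrite -und1; apply: pr_shift => //; vm_compute.
have V2_le : V2 <= V1 + T1.
  by rewrite -und1; apply: pr_le_add => //; vm_compute.
have Tb : pr (fun u => starts [:: Unknown; Zero; Zero; Zero] (behead u)) = T.
  by apply: pr_shift => //; vm_compute.
have Tbb : pr (fun u => starts [:: Unknown; Zero; Zero; Zero] (behead (behead u))) = T.
  by rewrite -Tb; apply: pr_shift => //; vm_compute.
have T1b : pr (fun u => starts [:: Unknown; Zero; Zero; Zero; One] (behead u)) = T1.
  by apply: pr_shift => //; vm_compute.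
have T0b : pr (fun u => starts [:: Unknown; Zero; Zero; Zero; Zero] (behead u)) = T0.
  by apply: pr_shift => //; vm_compute.
have Y_le : Y <= T + T0.
  by rewrite -Tb; apply: pr_le_add => //; vm_compute.
have N_le : N <= T + T0 + T00.
  rewrite -Tbb -T0b.
  pose h := pr (fun u => [|| starts [:: Unknown; Zero; Zero; Zero] (behead (behead u)) |
      starts [:: Unknown; Zero; Zero; Zero; Zero] (behead u)]).
  apply: (@le_trans _ _ (h + T00)); first by apply: pr_le_add => //; vm_compute.
  by rewrite lerD2r; apply: pr_le_add => //; vm_compute.
have T00_le : T00 <= T0 by apply: pr_le => //; vm_compute.
have T_le : T1 + T0 <= T.
  rewrite /T (pr_split _ e0_ge0 e1_ge0 e01_le1 _ _ (fun u => nth Unknown u 4 == One)).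
  by rewrite lerD//; apply: pr_le => //; vm_compute.
have V3_le : V3 <= V1 + T.
  pose h := pr (fun u => starts [:: Unknown; Zero; Zero; Zero; One] (behead u) ||
    starts [:: Unknown; Zero; Zero; Zero; Zero] u).
  apply: (@le_trans _ _ (V1 + h)).
    by rewrite -und2; apply: pr_le_add => //; vm_compute.
  rewrite lerD2l (le_trans _ T_le)// -T1b.
  by apply: pr_le_add => //; vm_compute.
have W_le : pr (starts [:: Unknown; Zero; Zero]) <= pr (starts [:: Unknown; Zero]).
  by apply: pr_le => //; vm_compute.
by apply: (three_balance e0_ge0 e1_ge0 e01_le1 e_neq0 e0_half _ _ _ _ _ _
  qU AE ZE FE W_le TE bal V2_le Y_le N_le T00_le T_le V3_le); exact: pr_ge0.
Qed.

End Three.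

(** * The topology and the Borel sets of the configuration space *)

Definition word (x : int -> letter) (i : int) (k : nat) : seq letter :=
  [seq x (i + l%:Z) | l <- iota 0 k].

Lemma size_word x i k : size (word x i k) = k.
Proof. by rewrite size_map size_iota. Qed.

Lemma nth_word a x i k l : (l < k)%N -> nth a (word x i k) l = x (i + l%:Z).
Proof. by move=> lk; rewrite (nth_map 0%N) ?size_iota// nth_iota. Qed.

Definition block (x : int -> letter) (N : nat) := word x (- N%:Z) N.*2.+1.

Lemma block_eqP x y N :
  block x N = block y N <-> (forall i : int, (`|i| <= N)%N -> x i = y i).
Proof.
split=> [xy i iN|xy].
  have := congr1 (fun u => nth Zero u (absz (i + N%:Z))) xy.
  rewrite !nth_word; [|by lia..].
  by rewrite (_ : - N%:Z + (absz (i + N%:Z))%:Z = i)//; lia.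
apply/eq_in_map => l; rewrite mem_iota => lN; apply: xy; lia.
Qed.

Lemma block_le x y M N : (M <= N)%N -> block x N = block y N -> block x M = block y M.
Proof.
by move=> MN /block_eqP xy; apply/block_eqP => i iM; apply: xy; exact: leq_trans MN.
Qed.

(** Convergence in the product topology is convergence of each coordinate, so
    the filter generated by the blocks around 0 converges. *)
Lemma nbhs_block (x : config) (U : set config) : nbhs x U ->
  exists N, forall y : config, block y N = block x N -> U y.
Proof.
pose F : set_system config :=
  [set A | exists N, forall y : config, block y N = block x N -> A y].
have FF : Filter F.
  split; first by exists 0%N.
  - move=> A B [M HM] [N HN]; exists (maxn M N) => y yx; split.
      by apply: HM; apply: block_le yx; exact: leq_maxl.
    by apply: HN; apply: block_le yx; exact: leq_maxr.
  - by move=> A B AB [M HM]; exists M => y /HM /AB.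
suff : F --> x by apply.
apply/cvg_sup => i A [B [[C oC <-] Cx] BA].
exists `|i|%N => y /block_eqP yx; apply: BA => /=.
by rewrite (yx i).
Qed.

Lemma open_coord (i : int) (S : set letter) : open [set x : config | S (x i)].
Proof.
apply: (@open_comp config letter (fun x : config => x i) S).
  by move=> x _; exact: (@proj_continuous _ (fun=> letter : topologicalType) i x).
exact: discrete_open.
Qed.

Lemma nbhs_coord (x : config) (s : seq int) : \forall y \near x, forall i, i \in s -> y i = x i.
Proof.
elim: s => [|i s IH]; first by apply: filterE.
have Hi : \forall y \near x, y i = x i.
  have : open_nbhs x [set y : config | [set x i] (y i)] by split => //; exact: open_coord.
  by move=> /open_nbhs_nbhs.
apply: filterS2 IH Hi => y ys yi j; rewrite inE => /predU1P[->//|]; exact: ys.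
Qed.

Lemma nbhs_blockeq (x : config) N : \forall y \near x, block y N = block x N.
Proof.
have := nbhs_coord x [seq - N%:Z + l%:Z | l <- iota 0 N.*2.+1].
apply: filterS => y H; apply/eq_in_map => l lN; apply: H.
by apply/mapP; exists l.
Qed.

Lemma config_compact : compact [set: config].
Proof.
have cl : compact [set: letter].
  have -> : [set: letter] = [set Zero] `|` [set One] `|` [set Unknown].
    by rewrite eqEsubset; split => // -[] _; [left;left|left;right|right].
  by do 2?apply: compactU; exact: compact_set1.
have := @tychonoff _ (fun _ : int => letter) _ (fun=> cl).
by congr (compact _); rewrite eqEsubset.
Qed.

(** Uniform continuity, from a finite cover of the compact configuration space
    by sets that depend on a block. *)
Lemma uniform_block (R : realType) (f : config -> R) : continuous f ->
  forall e, 0 < e -> exists N, forall x y : config, block x N = block y N ->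
    `|f x - f y| <= e.
Proof.
move=> cf e e0.
have Nx (x : config) : {N | forall y : config, block y N = block x N -> `|f x - f y| < e / 2}.
  apply/cid/(@nbhs_block x [set y | `|f x - f y| < e / 2]).
  have := cf x; move=> /cvgrPdist_lt /(_ (e / 2)); apply; lra.
have := config_compact; rewrite compact_cover.
move=> /(_ config setT (fun x : config => (interior [set y : config | block y (sval (Nx x)) = block x (sval (Nx x))]))) [].
- by move=> x _; exact: open_interior.
- move=> x _; exists x => //; exact: nbhs_blockeq.
move=> D _ cov; exists (\max_(x <- D) sval (Nx x)) => x y xy.
have [z zD /interior_subset /= xz] := cov x I.
have zN : (sval (Nx z) <= \max_(x <- D) sval (Nx x))%N.
  by rewrite (big_rem z)//= leq_maxl.
have yz : block y (sval (Nx z)) = block z (sval (Nx z)).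
  by rewrite -xz; apply/esym/(block_le zN).
move: (svalP (Nx z) _ xz) (svalP (Nx z) _ yz) => h1 h2.
rewrite (_ : f x - f y = (f z - f y) - (f z - f x)); last by ring.
by rewrite (le_trans (ler_normB _ _))// [leRHS](splitr e) lerD// ltW.
Qed.

(** Countable unions of sets that depend on a block exhaust the open sets;
    this is what makes the Borel sets accessible through words. *)
Lemma open_blocks (U : set config) : open U ->
  U = \bigcup_N [set x : config | exists2 v, v \in words N.*2.+1 &
     block x N = v /\ forall y : config, block y N = v -> U y].
Proof.
move=> oU; rewrite eqEsubset; split => x.
  move=> Ux; have /nbhs_block[N HN] : nbhs x U by apply: open_nbhs_nbhs.
  exists N => //; exists (block x N) => //.
  by apply/mem_words; rewrite size_word.
by move=> [N _ [v _ [xv H]]]; exact: H.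
Qed.

(** * Averages over random words *)

Lemma wordS x i k : word x i k.+1 = x i :: word x (i + 1) k.
Proof.
rewrite /word /= addr0 (iotaDl 1 0) -map_comp; congr (_ :: _).
by apply: eq_map => l /=; congr x; lia.
Qed.

(** The target of [X] is only a set of functions, without a sigma-algebra:
    measurability is stated for events about finite words. *)
Lemma measurable_word (d : measure_display) (Om : measurableType d)
  (X : Om -> int -> letter) :
  (forall i a, measurable [set w | X w i = a]) ->
  forall i k (S : set (seq letter)), measurable [set w | S (word (X w) i k)].
Proof.
move=> mX i k; elim: k i => [|k IH] i S.
  have [S0|nS0] := pselect (S [::]).
    rewrite (_ : [set w | _] = setT)//.
    by rewrite eqEsubset; split.
  rewrite (_ : [set w | _] = set0)//.
  by rewrite eqEsubset; split.
pose E a := [set w | X w i = a] `&` [set w | S (a :: word (X w) (i + 1) k)].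
rewrite (_ : [set w | _] = E Zero `|` E One `|` E Unknown).
  by do 2?apply: measurableU; apply: measurableI => //; apply: (IH _ (fun v => S (_ :: v))).
rewrite eqEsubset; split=> w /=.
  rewrite wordS; case e : (X w i) => Sw;
    [left; left|left; right|right]; split => //=.
by move=> [[]|] [] /= e; rewrite wordS e.
Qed.

Lemma measurable_borel (d : measure_display) (Om : measurableType d)
  (X : Om -> config) :
  (forall i a, measurable [set w | X w i = a]) ->
  forall B : set (borel config), measurable B -> measurable (X @^-1` B).
Proof.
move=> mX B mB; pose G := [set B : set config | measurable (X @^-1` B)].
suff : @measurable _ (borel config) `<=` G by apply.
apply: smallest_sub.
  split; rewrite /G /=.
  - by rewrite preimage_set0; exact: measurable0.
  - move=> A mA; rewrite setTD preimage_setC; exact: measurableC.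
  - move=> A mA; rewrite preimage_bigcup; exact: bigcupT_measurable.
move=> U oU; rewrite /G /= (open_blocks oU) preimage_bigcup.
apply: bigcupT_measurable => N.
pose S := [set v | v \in words N.*2.+1 /\ forall y : config, block y N = v -> U y].
rewrite (_ : _ @^-1` _ = [set w | S (word (X w) (- N%:Z) N.*2.+1)]).
  exact: measurable_word.
rewrite eqEsubset; split=> w /=.
  by move=> [v vw [<- H]]; split => //; apply/mem_words; rewrite size_word.
by move=> [vw H]; exists (word (X w) (- N%:Z) N.*2.+1).
Qed.

Lemma sum_wordsS (R : realType) k (g : seq letter -> R) :
  \sum_(v <- words k.+1) g v =
  \sum_(w <- words k) (g (Zero :: w) + g (One :: w) + g (Unknown :: w)).
Proof.
rewrite /= big_flatten /= big_map; apply: eq_bigr => w _.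
by rewrite !big_cons big_nil addr0 addrA.
Qed.

Lemma sum_words_pick (R : realType) k (g : seq letter -> R) u : size u = k ->
  \sum_(v <- words k) g v * (u == v)%:R = g u.
Proof.
elim: k g u => [|k IH] g [|a u]//=; first by rewrite big_seq1 eqxx mulr1.
move=> [su]; rewrite (sum_wordsS k (fun v => g v * (a :: u == v)%:R)).
rewrite -(IH (fun v => g (a :: v)) u)//; apply: eq_bigr => w _.
by rewrite !eqseq_cons; case: a; rewrite !(mulr0, add0r, addr0).
Qed.

Definition pattern_mass (R : realType) (ps : seq (letter -> R)) (v : seq letter) : R :=
  \prod_(pa <- zip ps v) pa.1 pa.2.

Lemma expect_sum (R : realType) (ps : seq (letter -> R)) f :
  expect ps f = \sum_(v <- words (size ps)) f v * pattern_mass ps v.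
Proof.
elim: ps f => [|p ps IH] f /=.
  by rewrite big_seq1 /pattern_mass big_nil mulr1.
rewrite (sum_wordsS _ (fun v => f v * pattern_mass (p :: ps) v)) !IH !mulr_sumr.
rewrite -!big_split; apply: eq_bigr => w _ /=.
by rewrite /pattern_mass /= !big_cons /=; ring.
Qed.

Section WordMeans.
Variables (R : realType) (d : measure_display) (Om : measurableType d).
Variable (P : probability Om R) (X : Om -> int -> letter).
Hypothesis mX : forall i a, measurable [set w | X w i = a].

Definition word_prob i k v : R := fine (P [set w | word (X w) i k = v]).
Definition word_mean i k (f : seq letter -> R) : R :=
  \sum_(v <- words k) f v * word_prob i k v.

Lemma word_probE i k v : P [set w | word (X w) i k = v] = (word_prob i k v)%:E.
Proof. by rewrite fineK// fin_num_measure//; apply: (measurable_word mX _ _ [set v]). Qed.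

Lemma integral_word i k (h : seq letter -> R) :
  (\int[P]_w (h (word (X w) i k))%:E = (word_mean i k h)%:E)%E.
Proof.
have mE v : measurable [set w | word (X w) i k = v].
  exact: (measurable_word mX _ _ [set v]).
transitivity (\int[P]_w (\sum_(v <- words k)
    (h v)%:E * (\1_[set w | word (X w) i k = v] w)%:E))%E.
  apply: eq_integral => w _; rewrite -[in LHS](@sum_words_pick _ k) ?size_word//.
  rewrite -sumEFin; apply: eq_bigr => v _; rewrite indicE -EFinM.
  congr (_ * (nat_of_bool _)%:R)%:E.
  by apply/eqP/idP => [e|/set_mem//]; rewrite inE.
rewrite integral_sum//.
  rewrite /word_mean -sumEFin; apply: eq_bigr => v _.
  rewrite integralZl//; last by apply: integrable_indic => //; rewrite fin_num_fun_lty.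
  by rewrite integral_indic// setIT EFinM; congr (_ * _)%E; exact: word_probE.
move=> v; apply: integrableZl => //.
by apply: integrable_indic => //; rewrite fin_num_fun_lty.
Qed.

Lemma word_mean_ge0 i k f : (forall v, 0 <= f v) -> 0 <= word_mean i k f.
Proof.
move=> f0; apply: sumr_ge0 => v _; rewrite mulr_ge0//; exact: fine_ge0.
Qed.

Lemma word_mean_lin i k a f b g :
  word_mean i k (fun v => a * f v + b * g v) = a * word_mean i k f + b * word_mean i k g.
Proof.
by rewrite /word_mean !mulr_sumr -big_split; apply: eq_bigr => v _ /=; ring.
Qed.

Lemma word_mean_cst i k c : word_mean i k (fun=> c) = c.
Proof.
apply: EFin_inj; rewrite -integral_word integral_cst//.
by rewrite [X in (_ * X)%E]probability_setT mule1.
Qed.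

Lemma eq_word_mean i k f g : (forall v, size v = k -> f v = g v) -> word_mean i k f = word_mean i k g.
Proof.
move=> fg; apply: EFin_inj; rewrite -!integral_word.
by apply: eq_integral => w _; rewrite fg// size_word.
Qed.

Lemma word_mean_le i k f g : (forall v, size v = k -> f v <= g v) -> word_mean i k f <= word_mean i k g.
Proof.
move=> fg; rewrite -subr_ge0.
have -> : word_mean i k g - word_mean i k f = word_mean i k (fun v => Num.max 0 (g v - f v)).
  rewrite -mulN1r -[X in X + _]mul1r -word_mean_lin; apply: eq_word_mean => v sv.
  by rewrite mul1r mulN1r max_r// subr_ge0 fg.
by apply: word_mean_ge0 => v; rewrite le_max lexx.
Qed.

End WordMeans.

(** * Chains act on words by the averaged dynamics *)

Lemma subword x i k j l : (j + l <= k)%N ->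
  take l (drop j (word x i k)) = word x (i + j%:Z) l.
Proof.
move=> jlk; rewrite /word -map_drop -map_take drop_iota take_iota.
rewrite (_ : minn _ _ = l); last by lia.
rewrite add0n -[X in iota X]addn0 iotaDl -map_comp; apply: eq_map => z /=.
by congr x; lia.
Qed.

Lemma local_rule_word (R : realType) m (e0 e1 : R) (x : config) i b :
  local_rule e0 e1 (@window m.+1 x i) b = rule e0 e1 (word x i m.+1) b.
Proof.
have E (a : letter) (Q : letter -> bool) :
    (forall y, Q y = (y == a)) ->
    [forall k, @window m.+1 x i k == a] = all Q (word x i m.+1) /\
    [exists k, @window m.+1 x i k == a] = has Q (word x i m.+1).
  move=> HQ; split.
    apply/forallP/allP => [H y /mapP[l]|H k].
      by rewrite mem_iota add0n => /= lm ->; rewrite HQ; exact: (H (Ordinal lm)).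
    by rewrite -HQ; apply: H; apply/mapP; exists (val k); rewrite ?mem_iota ?ltn_ord.
  apply/existsP/hasP => [[k Hk]|[y /mapP[l]]].
    exists (x (i + k%:Z)); last by rewrite HQ.
    by apply/mapP; exists (val k); rewrite ?mem_iota ?ltn_ord.
  by rewrite mem_iota add0n => /= lm ->; rewrite HQ => Hl; exists (Ordinal lm).
rewrite /local_rule (E Zero (pred1 Zero) _).1// (E One (pred1 One) _).2//.
rewrite /rule /open_value /noise.
by case: ifP => _; [|case: ifP => _]; case: b => /=; ring.
Qed.

Section Chain.
Variables (R : realType) (m : nat) (e0 e1 : R).
Variables (d : measure_display) (Om : measurableType d) (P : probability Om R).
Variable X : nat -> {RV P >-> borel config}.

Lemma measurable_chain t i a : measurable [set w | (X t w : config) i = a].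
Proof.
have := @measurable_funPT _ _ _ _ (X t) measurableT [set x : config | x i = a].
rewrite setTI; apply; apply: sub_sigma_algebra; exact: (open_coord i [set a]).
Qed.

Local Notation Xw t := (X t : Om -> int -> letter).

Hypothesis chainX : pca_chain m.+1 e0 e1 X.

Lemma word_prob_step t i k v : size v = k ->
  word_prob P (Xw t.+1) i k v = word_mean P (Xw t) i (k + m)
    (fun u => pattern_mass [seq rule e0 e1 (take m.+1 (drop l u)) | l <- iota 0 k] v).
Proof.
move=> sv; apply: EFin_inj; rewrite -integral_word; last exact: measurable_chain.
rewrite -word_probE; last exact: measurable_chain.
pose F := [seq i + l%:Z | l <- iota 0 k].
pose a (j : int) := nth Unknown v (absz (j - i)).
have uF : uniq F by rewrite map_inj_uniq ?iota_uniq// => y z; lia.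
have ST : history_sigma (fun s => X s : Om -> borel config) t setT.
  exact: (@measurableT _ (g_sigma_algebraType _)).
have := chainX a ST uF; rewrite setTI => H.
transitivity (P [set w | forall j, j \in F -> (X t.+1 w : config) j = a j]).
  congr (P _); rewrite eqEsubset; split=> w /=.
    move=> wv j /mapP[l]; rewrite mem_iota => lk ->.
    by rewrite /a -wv nth_word; [congr (X _ _ _)|]; lia.
  move=> Ha; apply: (@eq_from_nth _ Unknown); rewrite size_word// => l lk.
  rewrite nth_word// Ha; last by apply/mapP; exists l => //; rewrite mem_iota.
  by congr (nth _ _ _); lia.
rewrite H; apply: eq_integral => w _; congr EFin.
rewrite big_map /pattern_mass -[in RHS](mkseq_nth Unknown v) sv /mkseq zip_map big_map.
rewrite big_seq [RHS]big_seq; apply: eq_bigr => l; rewrite mem_iota => lk.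
rewrite local_rule_word /= subword; last by lia.
by congr (rule _ _ _ (nth _ _ _)); lia.
Qed.

(** The average of [f] over a word after one more step is the average of
    [update k f] over the longer word that determines it. *)
Lemma word_mean_step t i k f :
  word_mean P (Xw t.+1) i k f = word_mean P (Xw t) i (k + m) (update m e0 e1 k f).
Proof.
rewrite /word_mean big_seq.
under eq_bigr => v vw do rewrite word_prob_step ?(size_words vw)// /word_mean mulr_sumr.
rewrite -big_seq exchange_big /=; apply: eq_bigr => u _.
rewrite /update expect_sum size_map size_iota mulr_suml.
by apply: eq_bigr => v _; rewrite mulrA.
Qed.

End Chain.

(** * Every chain is close to the chain started from all unknown *)

Lemma word_le_known u v : word_le u v -> Unknown \notin u -> v = u.
Proof.
elim: u v => [|a u IH] [|b v]//= /andP[ab uv]; rewrite inE negb_or => /andP[a0 u0].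
rewrite (IH v)//; congr (_ :: _); move: ab; rewrite /letter_le eq_sym (negPf a0).
by move=> /= /eqP.
Qed.

Definition unknown_prob (R : realType) (m : nat) (e0 e1 : R) (t : nat) : R :=
  start_mean m e0 e1 t 1 (fun u => (u == [:: Unknown])%:R).

Section Compare.
Variables (R : realType) (m : nat) (e0 e1 : R).
Hypotheses (e0_ge0 : 0 <= e0) (e1_ge0 : 0 <= e1) (e01_le1 : e0 + e1 <= 1).

Local Notation start_mean := (start_mean m e0 e1).
Local Notation limit_mean := (limit_mean m e0 e1).
Local Notation undecided := (unknown_prob m e0 e1).

Lemma pca_mean_take_le t j k f x :
  pca_mean m e0 e1 t (j + k) (fun v => f (take k v)) x = pca_mean m e0 e1 t k f x.
Proof.
elim: j => [|j IH]; first by apply: eq_pca_mean => v; rewrite add0n => <-; rewrite take_size.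
rewrite -IH addSn -[RHS]pca_mean_take; apply: eq_pca_mean => v sv.
by rewrite take_takel// leq_addl.
Qed.

Lemma start_mean_undecided t k :
  start_mean t k (fun v => (Unknown \in v)%:R) <= k%:R * undecided t.
Proof.
elim: k => [|k IH].
  rewrite mul0r -(@pca_mean_cst _ m e0 e1 e0_ge0 e1_ge0 e01_le1 t 0 0 (fun=> Unknown)).
  by apply: pca_mean_le => // -[].
rewrite -natr1 mulrDl mul1r.
have E : undecided t = start_mean t k.+1 (fun v => (take 1 v == [:: Unknown])%:R).
  rewrite -[k.+1]addn1 /unknown_prob /start_mean.
  by rewrite (@pca_mean_take_le t k 1 (fun u => (u == [:: Unknown])%:R)).
apply: le_trans (lerD IH (lexx _)); rewrite [X in _ + X]E.
have -> : start_mean t k (fun v => (Unknown \in v)%:R) =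
          start_mean t k.+1 (fun v => (Unknown \in behead v)%:R).
  by rewrite /start_mean (pca_mean_behead _ _ _ _ _ (fun v => (Unknown \in v)%:R)).
rewrite /start_mean -pca_mean_add; apply: pca_mean_le => // -[//|a v] _.
rewrite /= inE -natrD ler_nat take0 eqseq_cons eqxx andbT.
by case: a; case: (_ \in v).
Qed.

Section OneChain.
Variables (d : measure_display) (Om : measurableType d) (P : probability Om R).
Variable X : nat -> {RV P >-> borel config}.
Hypothesis chainX : pca_chain m.+1 e0 e1 X.
Local Notation Xw t := (X t : Om -> int -> letter).

Lemma word_mean_mono_ge t i k f : mono f -> start_mean t k f <= word_mean P (Xw t) i k f.
Proof.
elim: t i k f => [|t IH] i k f mf.
  rewrite -(word_mean_cst P (measurable_chain X 0) i k (start_mean 0 k f)).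
  apply: word_mean_le; first exact: measurable_chain.
  move=> v sv; apply: mf; rewrite /mkseq.
  elim: v k sv => [|a v IH] [|k]//= [sv].
  by rewrite (iotaDl 1 0) -map_comp; exact: IH.
rewrite (word_mean_step chainX); apply: IH; exact: update_mono.
Qed.

Lemma word_mean_start t i k f : (forall w j, (X 0%N w : config) j = Unknown) ->
  word_mean P (Xw t) i k f = start_mean t k f.
Proof.
move=> X0; elim: t i k f => [|t IH] i k f; last by rewrite (word_mean_step chainX) IH.
apply: EFin_inj; rewrite -integral_word; last exact: measurable_chain.
under eq_integral => w _.
  rewrite (_ : word _ _ _ = mkseq (fun=> Unknown) k); last first.
    by apply/eq_in_map => l _; exact: X0.
  over.
by rewrite integral_cst// [X in (_ * X)%E]probability_setT mule1.
Qed.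

(** A function that vanishes on words containing [Unknown] and is nonnegative
    is monotone, as known words are maximal. *)
Lemma word_mean_known_ge t i k g : (forall v, 0 <= g v) ->
  (forall v, Unknown \in v -> g v = 0) -> start_mean t k g <= word_mean P (Xw t) i k g.
Proof.
move=> g_ge0 gU; apply: word_mean_mono_ge => u v uv.
by case: (boolP (Unknown \in u)) => [/gU->//|/(word_le_known uv)->].
Qed.

End OneChain.

(** The bounds of this section apply both to a chain and to the constant
    sequence of a candidate for the limit; their common property is that known
    words are at least as likely as in the chain started from all [Unknown]. *)
Section Domination.
Variables (d : measure_display) (Om : measurableType d) (P : probability Om R).
Variables (Y : nat -> Om -> int -> letter) (i : int).
Hypothesis mY : forall t j a, measurable [set w | Y t w j = a].
Hypothesis Y_ge : forall t k g, (forall v, 0 <= g v) ->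
  (forall v, Unknown \in v -> g v = 0) -> start_mean t k g <= word_mean P (Y t) i k g.

(** Throw away the words that contain [Unknown]; under the chain started from
    all [Unknown] this costs at most [M] for each of the [k] letters. *)
Lemma word_mean_lower t k f M : (forall v, size v = k -> 0 <= f v <= M) ->
  start_mean t k f - M * (k%:R * undecided t) <= word_mean P (Y t) i k f.
Proof.
move=> fM.
have M_ge0 : 0 <= M.
  by have /andP[+ +] := fM (nseq k Zero) (size_nseq _ _); exact: le_trans.
pose g v := if (size v == k) && (Unknown \notin v) then f v else 0.
have g_ge0 v : 0 <= g v.
  by rewrite /g; case: ifP => // /andP[/eqP /fM /andP[]].
have gU v : Unknown \in v -> g v = 0 by rewrite /g => ->; rewrite andbF.
apply: (@le_trans _ _ (start_mean t k g)); last first.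
  apply: (le_trans (Y_ge t k g_ge0 gU)); apply: word_mean_le; first exact: mY.
  by move=> v sv; rewrite /g sv eqxx; case: ifP => // _; have /andP[] := fM _ sv.
rewrite lerBlDr; apply: (@le_trans _ _ (start_mean t k (fun v => 1 * g v + M * (Unknown \in v)%:R))).
  apply: pca_mean_le => // v sv; rewrite /g sv eqxx /=; have /andP[f0 fm] := fM _ sv.
  by case: (Unknown \in v) => /=; rewrite mul1r ?mulr1 ?mulr0 ?addr0 ?add0r.
rewrite /start_mean pca_mean_lin mul1r lerD2l ler_wpM2l//; exact: start_mean_undecided.
Qed.

(** Applied to [f] and to its opposite, shifted to be nonnegative, the lower
    bound becomes two-sided. *)
Lemma word_mean_cvg k f : undecided @ \oo --> (0 : R) ->
  (fun t => word_mean P (Y t) i k f) @ \oo --> limit_mean k f.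
Proof.
move=> u0; have [M M_ge0 HM] := word_bounded k f.
have bound s : `|s| = 1 -> forall t,
    s * start_mean t k f - 2 * M * (k%:R * undecided t) <= s * word_mean P (Y t) i k f.
  move=> s1 t; rewrite -(lerD2r (M * 1)) addrAC.
  have -> : s * start_mean t k f + M * 1 = start_mean t k (fun v => s * f v + M * 1).
    by rewrite /start_mean (pca_mean_lin _ _ _ _ _ s f M (fun=> 1)) pca_mean_cst.
  have -> : s * word_mean P (Y t) i k f + M * 1 = word_mean P (Y t) i k (fun v => s * f v + M * 1).
    by rewrite (word_mean_lin _ _ _ _ s f M (fun=> 1)) word_mean_cst//; exact: mY.
  apply: word_mean_lower => v /HM fv; rewrite mulr1.
  have : `|s * f v| <= M by rewrite normrM s1 mul1r.
  by rewrite ler_norml => /andP[h1 h2]; apply/andP; split; lra.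
apply: (@squeeze_cvgr _ _ _ _ (fun t => start_mean t k f - 2 * M * (k%:R * undecided t))
   (fun t => start_mean t k f + 2 * M * (k%:R * undecided t))).
- apply: nearW => t; move: (bound 1 (normr1 _) t) (bound (-1) (normrN1 _) t).
  by rewrite !mul1r !mulN1r => h1 h2; apply/andP; split; lra.
- rewrite -[limit_mean _ _]subr0 -(mulr0 (2 * M)) -(mulr0 k%:R).
  by apply: cvgB; [exact: limit_mean_cvg|do 2?apply: cvgMr].
- rewrite -[limit_mean _ _]addr0 -(mulr0 (2 * M)) -(mulr0 k%:R).
  by apply: cvgD; [exact: limit_mean_cvg|do 2?apply: cvgMr].
Qed.

End Domination.
End Compare.

(** * The automaton driven by independent sites *)

Definition play_value (s : site) (o : letter) : letter :=
  match s with Trap => Zero | Target => One | Open => o end.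

(** Time runs forwards here, with [w t] the sites used for the step from time
    [t] to time [t.+1]. *)
Fixpoint evolve (m : nat) (w : nat -> int -> site) (t : nat) (i : int) : letter :=
  if t is t'.+1 then
    play_value (w t' i) (open_value (word (evolve m w t') i m.+1))
  else Unknown.

Definition iid_sites (R : realType) (I : eqType) (b0 b1 : R) (d : measure_display)
    (Om : measurableType d) (P : probability Om R) (W : I -> Om -> site) :=
  [/\ forall z s, measurable (W z @^-1` [set s]),
      forall z s, P (W z @^-1` [set s]) = (site_prob b0 b1 s)%:E
    & mutually_independent P W].

Lemma iid_reindex (R : realType) (I J : eqType) (b0 b1 : R) (d : measure_display)
    (Om : measurableType d) (P : probability Om R) (W : I -> Om -> site) (f : J -> I) :
  injective f -> iid_sites b0 b1 P W -> iid_sites b0 b1 P (fun j => W (f j)).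
Proof.
move=> fi [mW PW iW]; split => [z s|z s|F A uF]; [exact: mW|exact: PW|].
pose A' z := [set s | forall j, f j = z -> A j s].
have A'f j : A' (f j) = A j.
  by rewrite eqEsubset; split=> s /=; [exact|move=> ? j' /fi ->].
have := iW [seq f j | j <- F] A' _; rewrite map_inj_uniq// => /(_ uF).
rewrite big_map; under eq_bigr do rewrite A'f.
move=> <-; congr (P _); rewrite eqEsubset; split=> w /= H z.
  by move=> /mapP[j jF ->]; rewrite A'f; exact: H.
by move=> zF; have := H (f z) (map_f f zF); rewrite A'f.
Qed.

Section LetterPartition.
Variables (R : realType) (d : measure_display) (Om : measurableType d).
Variables (P : probability Om R) (L : Om -> letter).
Hypothesis mL : forall a, measurable [set w | L w = a].

Local Notation fiber a := [set w | L w = a].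

Lemma letter_partition (D : set Om) :
  D = (D `&` fiber Zero) `|` (D `&` fiber One) `|` (D `&` fiber Unknown).
Proof.
rewrite eqEsubset; split=> w /=; last by move=> [[|]|] [].
by move=> Dw; case e : (L w); [left;left|left;right|right].
Qed.

Lemma measure_letter (D : set Om) : measurable D ->
  P D = (P (D `&` fiber Zero) + P (D `&` fiber One) + P (D `&` fiber Unknown))%E.
Proof.
move=> mD; have mI a : measurable (D `&` fiber a) by exact: measurableI.
rewrite {1}[D]letter_partition measureU//; last 2 first.
- exact: measurableU.
- by rewrite -subset0 => w [[[_ /= e]|[_ /= e]] [_ /= e']]; move: e; rewrite e'.
rewrite measureU//.
by rewrite -subset0 => w [[_ /= e] [_ /= e']]; move: e; rewrite e'.
Qed.

Lemma integral_letter (A : set Om) (g : Om -> R) : measurable A ->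
  measurable_fun setT g -> (forall w, 0 <= g w) ->
  (\int[P]_(w in A) (g w)%:E = \int[P]_(w in A `&` fiber Zero) (g w)%:E +
    \int[P]_(w in A `&` fiber One) (g w)%:E +
    \int[P]_(w in A `&` fiber Unknown) (g w)%:E)%E.
Proof.
move=> mA mg g0; have mI a : measurable (A `&` fiber a) by exact: measurableI.
have mgE (D : set Om) : measurable_fun D (EFin \o g).
  by apply/measurable_EFinP; apply: measurable_funS mg.
rewrite {1}[A]letter_partition ge0_integral_setU//; last first.
- by apply/disj_setPS => w [[[_ /= e]|[_ /= e]] [_ /= e']]; move: e; rewrite e'.
- by move=> w _; rewrite lee_fin.
- exact: measurableU.
rewrite ge0_integral_setU//; first by move=> w _; rewrite lee_fin.
by apply/disj_setPS => w [[_ /= e] [_ /= e']]; move: e; rewrite e'.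
Qed.

End LetterPartition.

Section Evolution.
Variables (R : realType) (m : nat) (b0 b1 : R).
Variables (d : measure_display) (Om : measurableType d) (P : probability Om R).
Variable W : nat * int -> Om -> site.
Hypotheses (b0_ge0 : 0 <= b0) (b1_ge0 : 0 <= b1) (b01_le1 : b1 + b0 <= 1).
Hypothesis iidW : iid_sites b0 b1 P W.

Lemma measurable_site z (S : set site) : measurable (W z @^-1` S).
Proof.
have [mW _ _] := iidW.
pose E s := W z @^-1` [set s] `&` [set _ | S s].
have mE s : measurable (E s).
  rewrite /E; have [Ss|nSs] := pselect (S s).
    by rewrite (_ : [set _ | S s] = setT) ?setIT// eqEsubset; split.
  by rewrite (_ : [set _ | S s] = set0) ?setI0// eqEsubset; split.
rewrite (_ : _ @^-1` S = E Trap `|` E Target `|` E Open).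
  by do 2?apply: measurableU.
rewrite eqEsubset; split=> w /=; rewrite /E /=.
  by case: (W z w) => Sw; [left;left|left;right|right].
by move=> [[]|] [->].
Qed.

Lemma site_set_prob z (S : set site) : P (W z @^-1` S) =
  (`[< S Trap >]%:R * b1 + `[< S Target >]%:R * b0 + `[< S Open >]%:R * (1 - b0 - b1))%:E.
Proof.
have [mW PW _] := iidW.
pose E s := W z @^-1` [set s] `&` [set _ | S s].
have EE s : E s = W z @^-1` [set x | x = s /\ S s] by [].
have mE s : measurable (E s) by rewrite EE; exact: measurable_site.
have PE s : P (E s) = (`[< S s >]%:R * site_prob b0 b1 s)%:E.
  rewrite /E; case: asboolP => Ss.
    by rewrite (_ : [set _ | S s] = setT) ?setIT ?PW ?mul1r// eqEsubset; split.
  by rewrite (_ : [set _ | S s] = set0) ?setI0 ?measure0 ?mul0r// eqEsubset; split.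
rewrite (_ : _ @^-1` S = E Trap `|` E Target `|` E Open); last first.
  rewrite eqEsubset; split=> w /=; rewrite /E /=.
    by case: (W z w) => Sw; [left;left|left;right|right].
  by move=> [[]|] [->].
rewrite measureU//; last 2 first.
- exact: measurableU.
- by rewrite -subset0 => w [[[/= e _]|[/= e _]] [/= e' _]]; move: e; rewrite e'.
rewrite measureU//; last by rewrite -subset0 => w [[/= e _] [/= e' _]]; move: e; rewrite e'.
by rewrite !EFinD; congr (_ + _ + _)%E; exact: PE.
Qed.

Lemma measurable_sites (F : seq (nat * int)) (T : nat * int -> set site) :
  measurable [set w | forall z, z \in F -> T z (W z w)].
Proof.
elim: F => [|z F IH].
  by rewrite (_ : [set w | _] = setT)// eqEsubset; split.
rewrite (_ : [set w | _] =
    W z @^-1` T z `&` [set w | forall z, z \in F -> T z (W z w)]).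
  exact: measurableI (measurable_site _ _) IH.
rewrite eqEsubset; split=> w /=.
  by move=> h; split=> [|z' zF]; apply: h; rewrite inE ?eqxx// zF orbT.
by move=> [h h'] z'; rewrite inE => /predU1P[->//|]; exact: h'.
Qed.

Lemma site_play_prob z (o b : letter) :
  fine (P (W z @^-1` [set s | play_value s o = b])) =
  noise b1 b0 b + (1 - b1 - b0) * (o == b)%:R.
Proof.
have E (x y : letter) : `[< x = y >] = (x == y) by apply/asboolP/eqP.
by rewrite site_set_prob /= !E; case: o; case: b => /=; ring.
Qed.

(** Generators of the sigma-algebra of the sites used before time [t]. *)
Definition past (t : nat) : set (set Om) :=
  [set A | exists z S, (z.1 < t)%N /\ A = W z @^-1` S].

Lemma past_mono s t : (s <= t)%N -> <<s past s >> `<=` <<s past t >>.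
Proof.
move=> st; apply: sub_sigma_algebra2 => A [z [S [zs ->]]].
by exists z, S; split => //; exact: leq_trans st.
Qed.

Lemma past_measurable t A : <<s past t >> A -> measurable A.
Proof.
apply: smallest_sub A; first exact: sigma_algebra_measurable.
by move=> A [z [S [_ ->]]]; exact: measurable_site.
Qed.

(** Both sides are finite measures in [A] that agree on the finite cylinder
    events, which are stable under intersection and generate the past. *)
Lemma indep_past t (H : seq int) (S : int -> set site) A :
  uniq H -> <<s past t >> A ->
  P (A `&` [set w | forall i, i \in H -> S i (W (t, i) w)]) =
  (P A * (\prod_(i <- H) fine (P (W (t, i) @^-1` S i)))%:E)%E.
Proof.
have [_ _ iW] := iidW.
move=> uH pA; set c := \prod_(i <- H) _.
set C := [set w | _].
have mC : measurable C.
  rewrite (_ : C = [set w | forall z, z \in [seq (t, i) | i <- H] -> S z.2 (W z w)]).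
    exact: (measurable_sites _ (fun z => S z.2)).
  rewrite eqEsubset; split=> w /= h.
    by move=> _ /mapP[i iH ->]; exact: h.
  by move=> i iH; have := h (t, i); apply; apply/mapP; exists i.
have c_ge0 : 0 <= c by apply: prodr_ge0 => i _; exact: fine_ge0.
pose G : set (set Om) := [set A | exists F (T : nat * int -> set site),
  [/\ uniq F, (forall z, z \in F -> (z.1 < t)%N) &
      A = [set w | forall z, z \in F -> T z (W z w)]]].
have Gm : G `<=` measurable.
  by move=> _ [F [T [_ _ ->]]]; exact: measurable_sites.
have GT : G setT by exists [::], (fun=> setT); split => //; rewrite eqEsubset; split.
have GI : setI_closed G.
  move=> _ _ [F [T [uF Ft ->]]] [F' [T' [uF' Ft' ->]]].
  exists (undup (F ++ F')), (fun z => [set s | (z \in F -> T z s) /\ (z \in F' -> T' z s)]).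
  split; first exact: undup_uniq.
    by move=> z; rewrite mem_undup mem_cat => /orP[/Ft|/Ft'].
  rewrite eqEsubset; split=> w /=.
    by move=> [h h'] z _; split; [exact: h|exact: h'].
  move=> h; split=> z zF; have := h z; rewrite mem_undup mem_cat zF ?orbT.
    by move=> /(_ isT)[+ _]; exact.
  by move=> /(_ isT)[_ +]; exact.
suff : mrestr P mC A = mscale (NngNum c_ge0) P A.
  by rewrite /mrestr /mscale /= => ->; rewrite muleC.
have sG : <<s past t >> `<=` <<s G >>.
  apply: sub_sigma_algebra2 => B [z [T [zt ->]]].
  exists [:: z], (fun=> T); split => //; first by move=> z'; rewrite inE => /eqP->.
  rewrite eqEsubset; split=> w /=; first by move=> Tw z'; rewrite inE => /eqP->.
  by move=> /(_ z (mem_head _ _)).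
apply: (@g_sigma_algebra_measure_unique _ _ _ G Gm (fun=> setT)) => //.
- by rewrite bigcup_const.
- move=> B [F [T [uF Ft ->]]]; rewrite /mrestr /mscale /=.
  pose T' z := if (z.1 < t)%N then T z else S z.2.
  have u : uniq (F ++ [seq (t, i) | i <- H]).
    rewrite cat_uniq uF map_inj_uniq ?uH ?andbT; last by move=> ? ? [].
    by apply/hasPn => _ /mapP[i _ ->]; apply/negP => /Ft /=; rewrite ltnn.
  have := iW _ T' u; rewrite big_cat big_map.
  rewrite (_ : [set w | _] = [set w | forall z, z \in F -> T z (W z w)] `&` C).
    move=> h; apply: (etrans h); rewrite EFinM muleC; congr (_ * _)%E.
      by congr EFin; apply: eq_bigr => i _; rewrite /T' /= ltnn.
    apply/esym; apply: (etrans (iW F T uF)); congr EFin; rewrite big_seq [RHS]big_seq.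
    by apply: eq_bigr => z /Ft zt; rewrite /T' zt.
  rewrite eqEsubset; split=> w /=.
    move=> h; split=> [z zF|i iH].
      by have := h z; rewrite mem_cat zF /T' Ft//; exact.
    by have := h (t, i); rewrite mem_cat map_f ?orbT// /T' /= ltnn; exact.
  move=> [h h'] z; rewrite mem_cat => /orP[zF|/mapP[i iH ->]].
    by rewrite /T' Ft//; exact: h.
  by rewrite /T' /= ltnn; exact: h'.
- by move=> _; rewrite /= /mrestr setTI (le_lt_trans (probability_le1 _ _))// ltry.
- exact: sG.
Qed.

Definition evolution t (w : Om) : config := evolve m (fun s i => W (s, i) w) t.

Lemma evolution_past t i a : <<s past t >> [set w | evolution t w i = a].
Proof.
elim: t i a => [|t IH] i a.
  have [<-|ne] := pselect (Unknown = a).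
    rewrite (_ : [set w | _] = setT); last by rewrite eqEsubset; split.
    exact: (@measurableT _ (g_sigma_algebraType (past 0))).
  rewrite (_ : [set w | _] = set0); last by rewrite eqEsubset; split.
  exact: (@measurable0 _ (g_sigma_algebraType (past 0))).
pose E s := W (t, i) @^-1` [set s] `&`
  [set w | play_value s (open_value (word (evolution t w) i m.+1)) = a].
rewrite (_ : [set w | _] = E Trap `|` E Target `|` E Open); last first.
  rewrite eqEsubset; split=> w /=; rewrite /E /= /evolution /=.
    by case: (W (t, i) w) => Sw; [left;left|left;right|right].
  by move=> [[]|] [->].
have mE s : @measurable _ (g_sigma_algebraType (past t.+1)) (E s).
  apply: measurableI.
    by apply: sub_sigma_algebra; exists (t, i), [set s].
  apply: (@measurable_word _ (g_sigma_algebraType (past t.+1)) _ _ i m.+1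
    [set v | play_value s (open_value v) = a]) => j b.
  exact: (past_mono (leqnSn t)).
apply: (@measurableU _ (g_sigma_algebraType (past t.+1))); last exact: mE.
apply: (@measurableU _ (g_sigma_algebraType (past t.+1))); exact: mE.
Qed.

Lemma evolution_borel t s : (s <= t)%N ->
  forall B : set (borel config), measurable B -> <<s past t >> (evolution s @^-1` B).
Proof.
move=> st B mB.
apply: (@measurable_borel _ (g_sigma_algebraType (past t))) => // i a.
by apply: (past_mono st); exact: evolution_past.
Qed.

Lemma measurable_evolution t i a : measurable [set w | evolution t w i = a].
Proof. by apply: past_measurable; exact: evolution_past. Qed.

Lemma evolution_measurable t :
  measurable_fun setT (evolution t : Om -> borel config).
Proof. by move=> _ B mB; rewrite setTI; apply: (@past_measurable t); exact: evolution_borel. Qed.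

(** The sites of row [t] are treated one at a time.  Splitting [A] according to
    the outcome of the rule at the place [i] turns the condition on the new
    letter at [i] into a condition on the site [(t, i)]; such conditions are
    collected in [H] and [S] until only independence from the past is left. *)
Lemma evolution_law t (F H : seq int) (a : int -> letter) (S : int -> set site) A :
  uniq (F ++ H) -> <<s past t >> A ->
  P (A `&` [set w | forall i, i \in F -> evolution t.+1 w i = a i] `&`
     [set w | forall i, i \in H -> S i (W (t, i) w)]) =
  (\int[P]_(w in A) ((\prod_(i <- F) rule b1 b0 (word (evolution t w) i m.+1) (a i)) *
    (\prod_(i <- H) fine (P (W (t, i) @^-1` S i))))%:E)%E.
Proof.
elim: F H S A => [|i F IH] H S A uFH pA.
  under eq_integral do rewrite big_nil mul1r.
  rewrite integral_cst; last exact: past_measurable pA.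
  rewrite muleC.
  apply: etrans (indep_past S uFH pA).
  congr (P _).
  by rewrite eqEsubset; split=> w /=; [move=> [[]]|move=> []].
have uH : uniq (F ++ i :: H) by rewrite -cat1s uniq_catCA.
have iH : i \notin H.
  by move: uFH; rewrite /= mem_cat negb_or => /andP[/andP[]].
pose L w := open_value (word (evolution t w) i m.+1).
have pL b : <<s past t >> [set w | L w = b].
  apply: (@measurable_word _ (g_sigma_algebraType (past t)) _ _ i m.+1
    [set v | open_value v = b]) => j c; exact: evolution_past.
have mL b : measurable [set w | L w = b] by exact: past_measurable (pL b).
have mA := past_measurable pA.
pose Sb b j := if j == i then [set s | play_value s b = a i] else S j.
have SbH b : \prod_(j <- H) fine (P (W (t, j) @^-1` Sb b j)) =
    \prod_(j <- H) fine (P (W (t, j) @^-1` S j)).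
  rewrite big_seq [RHS]big_seq; apply: eq_bigr => j jH.
  by rewrite /Sb; case: eqP jH => // ->; rewrite (negPf iH).
pose g w := (\prod_(j <- i :: F) rule b1 b0 (word (evolution t w) j m.+1) (a j)) *
  \prod_(j <- H) fine (P (W (t, j) @^-1` S j)).
have part b : P (A `&` [set w | forall j, j \in i :: F -> evolution t.+1 w j = a j] `&`
     [set w | forall j, j \in H -> S j (W (t, j) w)] `&` [set w | L w = b]) =
   (\int[P]_(w in A `&` [set w | L w = b]) (g w)%:E)%E.
  have pAb : <<s past t >> (A `&` [set w | L w = b]).
    by apply: (@measurableI _ (g_sigma_algebraType (past t))); [exact: pA|exact: pL].
  rewrite (_ : _ `&` _ `&` _ `&` _ = A `&` [set w | L w = b] `&`
     [set w | forall j, j \in F -> evolution t.+1 w j = a j] `&`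
     [set w | forall j, j \in i :: H -> Sb b j (W (t, j) w)]); last first.
    rewrite eqEsubset; split=> w /=.
      move=> [[[Aw hF] hH] Lw]; split; first split=> // j jF.
        by apply: hF; rewrite inE jF orbT.
      move=> j; rewrite inE /Sb => /orP[/eqP->|jH].
        by rewrite eqxx /= -Lw; exact: hF (mem_head _ _).
      by case: eqP jH => [->|_ /hH//]; rewrite (negPf iH).
    move=> [[[Aw Lw] hF] hH]; split=> //; split; first split=> // j.
      rewrite inE => /orP[/eqP->|/hF//].
      by have := hH i (mem_head _ _); rewrite /Sb eqxx /= -Lw.
    move=> j jH; have := hH j; rewrite inE jH orbT /Sb => /(_ isT).
    by case: eqP jH => // ->; rewrite (negPf iH).
  rewrite IH//; apply: eq_integral => w; rewrite inE => -[_ /= Lw].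
  rewrite /g !big_cons SbH {1}/Sb eqxx site_play_prob -Lw.
  by congr EFin; rewrite /rule /L; ring.
rewrite (measure_letter P mL); last first.
  apply: measurableI; last first.
    rewrite (_ : [set w | _] = [set w | forall z, z \in [seq (t, j) | j <- H] -> S z.2 (W z w)]).
      exact: (measurable_sites _ (fun z => S z.2)).
    rewrite eqEsubset; split=> w /= h.
      by move=> _ /mapP[j jH ->]; exact: h.
    by move=> j jH; have := h (t, j); apply; apply/mapP; exists j.
  apply: measurableI => //; elim: (i :: F) => [|j s IHs].
    by rewrite (_ : [set w | _] = setT)// eqEsubset; split.
  rewrite (_ : [set w | _] = [set w | evolution t.+1 w j = a j] `&`
    [set w | forall j, j \in s -> evolution t.+1 w j = a j]).
    by apply: measurableI IHs; exact: measurable_evolution.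
  rewrite eqEsubset; split=> w /=.
    by move=> h; split=> [|z' zF]; apply: h; rewrite inE ?eqxx// zF orbT.
  by move=> [h h'] z'; rewrite inE => /predU1P[->//|]; exact: h'.
rewrite !part -(@integral_letter _ _ _ P L)//.
  apply: measurable_funM => //; apply: measurable_prod => j _.
  move=> _ Y mY; rewrite setTI.
  apply: (measurable_word (X := evolution t) _ j m.+1 [set v | Y (rule b1 b0 v (a j))]).
  exact: measurable_evolution.
by move=> w; rewrite mulr_ge0// prodr_ge0// => j _; [exact: rule_ge0|exact: fine_ge0].
Qed.

End Evolution.

Definition random_variable (R : realType) (d : measure_display) (Om : measurableType d)
    (P : probability Om R) (T : ptopologicalType) (X : Om -> borel T)
    (mX : measurable_fun setT X) : {RV P >-> borel T} :=
  HB.pack X (isMeasurableFun.Build _ _ _ _ X mX).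

Section EvolutionChain.
Variables (R : realType) (m : nat) (b0 b1 : R).
Variables (d : measure_display) (Om : measurableType d) (P : probability Om R).
Variable W : nat * int -> Om -> site.
Hypotheses (b0_ge0 : 0 <= b0) (b1_ge0 : 0 <= b1) (b01_le1 : b1 + b0 <= 1).
Hypothesis iidW : iid_sites b0 b1 P W.

Definition evolution_rv t : {RV P >-> borel config} :=
  random_variable P (evolution_measurable m iidW t).

Lemma evolution_chain : pca_chain m.+1 b1 b0 evolution_rv.
Proof.
move=> t A F a hA uF.
have pA : <<s past W t >> A.
  move: A hA; apply: smallest_sub; first exact: smallest_sigma_algebra.
  by move=> _ [s st [B mB ->]]; exact: evolution_borel mB.
have := @evolution_law _ m _ _ _ _ P W b0_ge0 b1_ge0 b01_le1 iidW t F [::] a (fun=> setT) A.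
rewrite cats0 => /(_ uF pA) H.
transitivity (P (A `&` [set w | forall i : int, i \in F -> evolution m W t.+1 w i = a i] `&`
     [set w | forall i, i \in [::] -> (fun=> setT : set site) i (W (t, i) w)])).
  congr (P _); rewrite eqEsubset; split=> w /=; first by move=> [Aw hF]; split.
  by move=> [].
rewrite H; apply: eq_integral => w _; rewrite big_nil mulr1; congr EFin.
by apply: eq_bigr => i _; rewrite local_rule_word.
Qed.

Lemma evolution_word t i k f : word_mean P (evolution m W t) i k f = start_mean m b1 b0 t k f.
Proof. exact: (word_mean_start evolution_chain). Qed.

End EvolutionChain.

(** * Existence of a board with independent sites *)

(** The independent sites are the digits of a uniform random point of the unit
    interval in the expansion whose digits are [Trap], [Target], [Open] with
    intervals of lengths [b1], [b0], [1 - b0 - b1]: the points with given first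
    digits form an interval whose length is the product of the lengths. *)
Section Digits.
Variables (R : realType) (b0 b1 : R).
Hypotheses (b0_ge0 : 0 <= b0) (b1_ge0 : 0 <= b1) (b01_le1 : b0 + b1 <= 1).

Local Notation p := (site_prob b0 b1).

Definition digit (x : R) : site :=
  if x < b1 then Trap else if x < b1 + b0 then Target else Open.

Definition left_end (a : site) : R :=
  match a with Trap => 0 | Target => b1 | Open => b1 + b0 end.

Definition stretch (x : R) : R := (x - left_end (digit x)) / p (digit x).

Definition digit_at (k : nat) (x : R) : site := digit (iter k stretch x).

Fixpoint cyl_left (s : seq site) : R :=
  if s is a :: s' then left_end a + p a * cyl_left s' else 0.

Fixpoint cyl_size (s : seq site) : R :=
  if s is a :: s' then p a * cyl_size s' else 1.

Fixpoint has_prefix (s : seq site) (x : R) : Prop :=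
  if s is a :: s' then digit x = a /\ has_prefix s' (stretch x) else True.

Lemma site_prob_ge0 a : 0 <= p a.
Proof. by move: b0_ge0 b1_ge0 b01_le1; case: a => //= *; lra. Qed.

Lemma cyl_bounds s : [/\ 0 <= cyl_left s, 0 <= cyl_size s & cyl_left s + cyl_size s <= 1].
Proof.
elim: s => [|a s [IH0 IH1 IH2]] /=; first by rewrite add0r.
have pa := site_prob_ge0 a.
have la : 0 <= left_end a by case: (a) => //=; rewrite addr_ge0.
split; [by rewrite addr_ge0 ?mulr_ge0|by rewrite mulr_ge0|].
rewrite -addrA -mulrDr; apply: (@le_trans _ _ (left_end a + p a * 1)).
  by rewrite lerD2l ler_wpM2l.
by move: b01_le1 b0_ge0 b1_ge0; case: a {pa la} => /= *; lra.
Qed.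

Lemma digitP x a : 0 <= x < 1 -> (digit x = a <-> left_end a <= x < left_end a + p a).
Proof.
move=> /andP[x0 x1]; move: b0_ge0 b1_ge0 => h0 h1.
rewrite /digit; case: (ltP x b1) => xb1; last case: (ltP x (b1 + b0)) => xb2.
all: case: a => /=; split=> [e|/andP[h2 h3]].
all: first [discriminate|reflexivity|(apply/andP; split; lra)|(exfalso; lra)].
Qed.

Lemma has_prefixP s x : 0 <= x < 1 ->
  (has_prefix s x <-> cyl_left s <= x < cyl_left s + cyl_size s).
Proof.
elim: s x => [|a s IH] x x01 /=; first by rewrite add0r x01.
have [lo0 sz0 hi1] := cyl_bounds s.
have [p0|pN0] := eqVneq (p a) 0.
  rewrite p0 !mul0r !addr0; split=> [[/digitP]|/andP[h1 h2]].
    by move=> /(_ x01); rewrite p0 addr0 => /andP[h1 h2]; exfalso; lra.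
  exfalso; lra.
have pa : 0 < p a by rewrite lt_neqAle eq_sym pN0 site_prob_ge0.
have E y : (y <= (x - left_end a) / p a) = (left_end a + p a * y <= x).
  by rewrite ler_pdivlMr// lerBrDl mulrC.
have E' y : ((x - left_end a) / p a < y) = (x < left_end a + p a * y).
  by rewrite ltr_pdivrMr// ltrBlDl mulrC.
split=> [[da]|].
  have /(digitP _ x01)/andP[h1 h2] := da.
  rewrite /stretch da IH; first by rewrite E E' mulrDr addrA.
  by rewrite E E' mulr0 addr0 mulr1 h1 h2.
move=> /andP[h1 h2].
have da : digit x = a.
  apply/digitP => //; apply/andP; split.
    by apply: le_trans h1; rewrite lerDl mulr_ge0// ltW.
  apply: (lt_le_trans h2); rewrite -addrA -mulrDr lerD2l -[leRHS]mulr1.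
  by rewrite ler_wpM2l// ltW.
split=> //; rewrite /stretch da IH; first by rewrite E E' mulrDr addrA h1 h2.
move: (x01); have /(digitP _ x01)/andP[h3 h4] := da.
by rewrite E E' mulr0 addr0 mulr1 h3 h4.
Qed.

Lemma has_prefix_rcons s a x :
  has_prefix (rcons s a) x <-> has_prefix s x /\ digit_at (size s) x = a.
Proof.
elim: s x => [|c s IH] x /=; first by rewrite /digit_at /=; tauto.
by rewrite IH /digit_at iterSr; tauto.
Qed.

Lemma cyl_size_rcons s a : cyl_size (rcons s a) = cyl_size s * p a.
Proof. by elim: s => [|c s IH] /=; rewrite ?mulr1 ?mul1r// IH mulrA. Qed.

Local Notation unif := (uniform_prob (@ltr01 R)).
Local Notation Om := (measurableTypeR R).

Lemma unif_itv (x y : R) : 0 <= x -> x <= y -> y <= 1 ->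
  unif `[x, y[ = (y - x)%:E.
Proof.
move=> x0 xy y1; rewrite /uniform_prob integral_uniform_pdf setIidl; last first.
  by move=> z /=; rewrite !in_itv /= => /andP[h1 h2]; apply/andP; split; lra.
under eq_integral => z zxy.
  rewrite /uniform_pdf (_ : (0 <= z <= 1) = true) ?subr0 ?invr1; last first.
    by move: zxy; rewrite inE /= in_itv /= => /andP[h1 h2]; apply/andP; split; lra.
  over.
rewrite /= integral_cst//= lebesgue_measure_itv /= lte_fin mul1e.
by move: xy; rewrite le_eqVlt => /predU1P[->|->]; rewrite ?ltxx ?subrr// EFinB.
Qed.

Lemma unif01 : unif `[0%R, 1%R[ = 1%:E.
Proof. by rewrite unif_itv// subr0. Qed.

Lemma unif_restrict (A : set Om) : measurable A -> unif A = unif (A `&` `[0%R, 1%R[).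
Proof.
move=> mA; have m01 : measurable (`[0%R, 1%R[ : set Om) by exact: measurable_itv.
have -> : unif A = (unif (A `&` `[0%R, 1%R[) + unif (A `\` `[0%R, 1%R[))%E.
  rewrite -measureU//; [|exact: measurableI|exact: measurableD|].
    by rewrite -setIUr setUv setIT.
  by rewrite -subset0 => z [[_ h] [_ /(_ h)]].
rewrite [X in (_ + X)%E](_ : _ = 0%E) ?adde0//.
apply/eqP; rewrite eq_le measure_ge0 andbT.
have -> : 0%E = unif (~` `[0%R, 1%R[).
  apply/esym; apply: (etrans (probability_setC _ m01)).
  by rewrite [X in (_ - X)%E](_ : _ = 1%:E) ?subee//; exact: unif01.
by apply: le_measure; rewrite ?inE; [exact: measurableD|exact: measurableC|move=> z []].
Qed.

Definition site_mass (B : set site) : R :=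
  `[< B Trap >]%:R * b1 + `[< B Target >]%:R * b0 + `[< B Open >]%:R * (1 - b0 - b1).

Definition digit_event (s : seq site) (N : nat) (B : nat -> set site) : set Om :=
  [set x | [/\ 0 <= x < 1, has_prefix s x &
    forall k, (size s <= k < size s + N)%N -> B k (digit_at k x)]].

(** Induction on the number of digits that are restricted to a set: splitting
    according to the first of them lengthens the prefix [s]. *)
Lemma digit_event_measure s N B : measurable (digit_event s N B) /\
  unif (digit_event s N B) = (cyl_size s * \prod_(size s <= k < size s + N) site_mass (B k))%:E.
Proof.
elim: N s => [|N IH] s.
  have [lo0 sz0 hi1] := cyl_bounds s.
  have -> : digit_event s 0 B = [set` `[cyl_left s, cyl_left s + cyl_size s[].
    rewrite eqEsubset; split=> x /=; rewrite in_itv /=.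
      by move=> [x01 /has_prefixP -> //].
    move=> h; have x01 : 0 <= x < 1.
      by move/andP: h => [h1 h2]; rewrite (le_trans lo0 h1) (lt_le_trans h2 hi1).
    split=> //; first exact/has_prefixP.
    by move=> k; rewrite addn0 leqNgt; case: ltnP.
  split; first exact: measurable_itv.
  rewrite unif_itv// ?lerDl// addn0 big_geq// mulr1; congr EFin.
  by rewrite addrC addKr.
pose E a := digit_event (rcons s a) N B `&` [set _ | B (size s) a].
have -> : digit_event s N.+1 B = E Trap `|` E Target `|` E Open.
  have H a x : E a x <-> digit_event s N.+1 B x /\ digit_at (size s) x = a.
    rewrite /E /digit_event /=; split.
      move=> [[x01 /has_prefix_rcons[hs da] hB] Ba]; split=> //; split=> // k.
      rewrite leq_eqVlt => /andP[/orP[/eqP<- _|h1 h2]]; first by rewrite da.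
      by apply: hB; rewrite size_rcons h1 addSnnS.
    move=> [[x01 hs hB] da]; split; last by rewrite -da; apply: hB; lia.
    split=> //; first exact/has_prefix_rcons.
    by move=> k; rewrite size_rcons => /andP[h1 h2]; apply: hB; lia.
  rewrite eqEsubset; split=> x.
    move=> hx; case e : (digit_at (size s) x);
      [left; left|left; right|right]; exact/H.
  by move=> [[|]|] /H[].
have mE a : measurable (E a) /\ unif (E a) =
   (`[< B (size s) a >]%:R * (cyl_size s * p a * \prod_((size s).+1 <= k < size s + N.+1) site_mass (B k)))%:E.
  have [mI uI] := IH (rcons s a); rewrite /E.
  case: asboolP => Ba.
    rewrite (_ : [set _ | _] = setT) ?setIT; last by rewrite eqEsubset; split.
    by rewrite uI mul1r cyl_size_rcons size_rcons addSnnS.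
  rewrite (_ : [set _ | _] = set0) ?setI0; last by rewrite eqEsubset; split.
  by rewrite measure0 mul0r.
have disj a b : a <> b -> E a `&` E b = set0.
  move=> ab; rewrite -subset0 => x [[[_ /has_prefix_rcons[_ da] _] _]].
  by move=> [[_ /has_prefix_rcons[_ db] _] _]; apply: ab; rewrite -da -db.
have mE' a := (mE a).1.
split; first by do 2?apply: measurableU.
rewrite measureU//; [|exact: measurableU|by rewrite setIUl !disj// setU0].
rewrite measureU//; last exact: disj.
transitivity ((`[< B (size s) Trap >]%:R * (cyl_size s * p Trap * \prod_((size s).+1 <= k < size s + N.+1) site_mass (B k)))%:E +
 (`[< B (size s) Target >]%:R * (cyl_size s * p Target * \prod_((size s).+1 <= k < size s + N.+1) site_mass (B k)))%:E +
 (`[< B (size s) Open >]%:R * (cyl_size s * p Open * \prod_((size s).+1 <= k < size s + N.+1) site_mass (B k)))%:E)%E.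
  by congr (_ + _ + _)%E; exact: (mE _).2.
rewrite -!EFinD; congr EFin; rewrite [in RHS]big_ltn; last by lia.
rewrite /site_mass /=; ring.
Qed.

(** Off the interval [0, 1) the digits have no meaning, and a fixed site is
    used there to have measurable events on the whole line. *)
Definition digit_board (I : countType) (z : I) (x : Om) : site :=
  if 0 <= x < 1 then digit_at (choice.pickle z) x else Open.

Lemma digit_board_event (I : countType) (F : seq I) (A : I -> set site) : uniq F ->
  measurable [set x | forall z, z \in F -> A z (digit_board z x)] /\
  unif [set x | forall z, z \in F -> A z (digit_board z x)] =
    (\prod_(z <- F) site_mass (A z))%:E.
Proof.
move=> uF; set E := [set x | _].
pose N := (\max_(z <- F) choice.pickle z).+1.
have FN z : z \in F -> (choice.pickle z < N)%N.
  by move=> zF; rewrite ltnS (big_rem z)//= leq_maxl.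
pose B k := [set a | forall z, z \in F -> choice.pickle z = k -> A z a].
have [mD uD] := digit_event_measure [::] N B.
have ED : E `&` `[0%R, 1%R[ = digit_event [::] N B.
  rewrite eqEsubset; split=> x /=; rewrite /E /digit_event /= in_itv /=.
    move=> [h x01]; split=> // k _ z zF <-.
    by have := h z zF; rewrite /digit_board x01.
  move=> [x01 _ h]; split=> // z zF; rewrite /digit_board x01.
  by apply: (h (choice.pickle z)) => //; rewrite add0n FN.
have m01 : measurable (`[0%R, 1%R[ : set Om) by exact: measurable_itv.
have mE : measurable E.
  rewrite -(setIT E) -(setUv (`[0%R, 1%R[ : set Om)) setIUr ED.
  apply: measurableU => //.
  have [AO|nAO] := pselect (forall z, z \in F -> A z Open).
    rewrite (_ : E `&` _ = ~` `[0%R, 1%R[); first exact: measurableC.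
    rewrite eqEsubset; split=> x /=; rewrite in_itv /=; first by move=> [].
    move=> /negP/negPf x01; split; last by rewrite x01.
    by move=> z zF; rewrite /digit_board x01; exact: AO.
  rewrite (_ : E `&` _ = set0)//.
  rewrite -subset0 => x /= [h]; rewrite in_itv /= => /negP/negPf x01; apply: nAO => z zF.
  by have := h z zF; rewrite /digit_board x01.
split=> //; rewrite unif_restrict// ED uD mul1r; congr EFin.
rewrite add0n /index_iota subn0.
transitivity (\prod_(k <- iota 0 N | k \in [seq choice.pickle z | z <- F]) site_mass (B k)).
  rewrite [RHS]big_mkcond; apply: eq_bigr => k _; case: ifP => // kF.
  have BT a : B k a.
    by move=> z zF zk; move: kF; rewrite -zk map_f.
  by rewrite /site_mass !(asboolT (BT _)) /=; ring.
rewrite -big_filter.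
have -> : \prod_(k <- [seq k <- iota 0 N | k \in [seq choice.pickle z | z <- F]]) site_mass (B k) =
  \prod_(k <- [seq choice.pickle z | z <- F]) site_mass (B k).
  apply: perm_big; apply: uniq_perm.
  - by rewrite filter_uniq// iota_uniq.
  - by rewrite map_inj_uniq//; exact: (pcan_inj choice.pickleK).
  - move=> k; rewrite mem_filter mem_iota add0n /=.
    by case: mapP => //= -[z zF ->]; rewrite FN.
rewrite big_map big_seq [RHS]big_seq; apply: eq_bigr => z zF.
rewrite (_ : B (choice.pickle z) = A z)// eqEsubset; split=> a /=; first by apply.
by move=> Az z' _ /(pcan_inj choice.pickleK) ->.
Qed.

Lemma iid_digit_board (I : countType) : iid_sites b0 b1 unif (@digit_board I).
Proof.
have one (z : I) (S : set site) : measurable (digit_board z @^-1` S) /\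
    unif (digit_board z @^-1` S) = (site_mass S)%:E.
  have := @digit_board_event I [:: z] (fun=> S) isT; rewrite big_seq1.
  rewrite (_ : [set x | _] = digit_board z @^-1` S)//.
  rewrite eqEsubset; split=> x /=; first by apply; rewrite inE.
  by move=> Sz z'; rewrite inE => /eqP->.
split=> [z a|z a|F A uF]; [exact: (one z [set a]).1| |].
  apply: (etrans (one z [set a]).2); congr EFin; rewrite /site_mass.
  by case: a; rewrite (asboolT erefl) !asboolF//=; ring.
apply: (etrans (digit_board_event A uF).2); congr EFin.
apply: eq_bigr => z _; apply/esym/EFin_inj; rewrite -(one z (A z)).2 fineK//.
by apply: fin_num_measure; exact: (one z (A z)).1.
Qed.

End Digits.

(** * Values of positions and winning strategies *)

Section Game.
Variables (m : nat) (b : board).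

(** What the [t] rows of sites from row [z.2] on tell about the fate of the
    player who moves the token to [z]: [One] for a win, [Zero] for a loss.  Row
    [z.2] comes last in the evolution, whence the reversed indexing of rows. *)
Definition value (t : nat) (z : int * int) : letter :=
  evolve m (fun s i => b (i, z.2 + t%:Z - 1 - s%:Z)) t z.1.

Lemma valueS t i j : value t.+1 (i, j) =
  play_value (b (i, j)) (open_value (word (fun i' => value t (i', j + 1)) i m.+1)).
Proof.
rewrite /value /=; congr (play_value (b (i, _)) (open_value _)); first by lia.
apply/eq_in_map => l _; congr evolve; apply/funext => s; apply/funext => i'.
by congr (b (i', _)); lia.
Qed.

Lemma word_le_word x y i k : (forall j, letter_le (x j) (y j)) ->
  word_le (word x i k) (word y i k).
Proof. by move=> xy; rewrite /word; elim: (iota 0 k) => //= l s ->; rewrite xy. Qed.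

Lemma value_le t z : letter_le (value t z) (value t.+1 z).
Proof.
elim: t z => [//|t IH] [i j]; rewrite !valueS.
case: (b _) => //=; apply/open_value_mono/word_le_word => l; exact: IH.
Qed.

Lemma value_mono s t z : (s <= t)%N -> letter_le (value s z) (value t z).
Proof.
move=> /subnK <-; elim: (t - s)%N => [|k IH]; first exact: letter_le_refl.
exact: letter_le_trans IH (value_le _ _).
Qed.

Lemma value_stable s t z : (s <= t)%N -> value s z <> Unknown -> value t z = value s z.
Proof.
move=> st; have := value_mono z st; rewrite /letter_le => /orP[/eqP->//|/eqP->//].
Qed.

Definition step (z : int * int) (k : 'I_m.+1) : int * int := (z.1 + (k : nat)%:Z, z.2 + 1).

Lemma token_rcons (h : seq 'I_m.+1) k : token (rcons h k) = step (token h) k.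
Proof.
rewrite /token /step /= size_rcons big_rcons /=; congr (_, _); lia.
Qed.

Lemma word_step (x : int * int -> letter) z :
  word (fun i => x (i, z.2 + 1)) z.1 m.+1 = [seq x (step z k) | k <- enum 'I_m.+1].
Proof. by rewrite /word -val_enum_ord -map_comp. Qed.

Lemma value_open t z : b z = Open ->
  (value t.+1 z = One -> forall k, value t (step z k) = Zero) /\
  (value t.+1 z = Zero -> exists k, value t (step z k) = One).
Proof.
case: z => i j bz; rewrite valueS bz /= (word_step (value t) (i, j)) /open_value.
split.
  case: ifP => [/allP h _ k|_]; last by case: ifP.
  by apply/eqP/h; apply/mapP; exists k; rewrite ?mem_enum.
case: ifP => // _; case: ifP => // /hasP[_ /mapP[k _ ->] /eqP h] _.
by exists k.
Qed.

Definition winning_move (t : nat) (z : int * int) (k : 'I_m.+1) : bool :=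
  value t (step z k) == One.

(** Playing for the least horizon at which some move wins ensures that the
    horizon decreases along the play, so that the win comes in finite time. *)
Definition attack : strategy m.+1 := fun h =>
  match pselect (exists t, [exists k, winning_move t (token h) k]) with
  | left ex => odflt ord0 [pick k | winning_move (ex_minn ex) (token h) k]
  | right _ => ord0
  end.

Lemma attackP t h : (exists k, winning_move t (token h) k) ->
  exists2 t', (t' <= t)%N & winning_move t' (token h) (attack h).
Proof.
move=> [k wk]; rewrite /attack; case: pselect => [ex|[]]; last first.
  by exists t; apply/existsP; exists k.
case: ex_minnP => t' /existsP[k' wk'] tmin; exists t'.
  by apply: tmin; apply/existsP; exists k.
by case: pickP => [//|/(_ k')]; rewrite wk'.
Qed.

(** A player who uses [attack] and has a winning move at horizon [t], or whose
    opponent only has moves to positions of value [Zero] at horizon [t], wins: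
    each move of the game lowers the horizon, and a horizon 0 is impossible
    because all values are unknown there. *)
Lemma attack_wins p (s1 s2 : strategy m.+1) :
  (forall t, mover t = p -> (if odd t then s2 else s1) = attack) ->
  forall t s, (forall u, (0 < u <= s)%N -> b (token (moves s1 s2 u)) = Open) ->
  (mover s = p -> (exists k, winning_move t (token (moves s1 s2 s)) k) -> wins b p s1 s2) /\
  (mover s <> p -> (forall k, value t (step (token (moves s1 s2 s)) k) = Zero) -> wins b p s1 s2).
Proof.
move=> att; elim/ltn_ind => t IH s opn.
have tokS u : token (moves s1 s2 u.+1) =
    step (token (moves s1 s2 u)) ((if odd u then s2 else s1) (moves s1 s2 u)).
  by rewrite /= token_rcons.
have opnS : b (token (moves s1 s2 s.+1)) = Open ->
    forall u, (0 < u <= s.+1)%N -> b (token (moves s1 s2 u)) = Open.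
  move=> bO u /andP[u0]; rewrite leq_eqVlt ltnS => /predU1P[->//|us].
    by apply: opn; rewrite u0.
have flip : mover s.+1 = if mover s is First then Second else First.
  by rewrite /mover /=; case: odd.
split=> [ms /attackP[[|t'] t't /eqP]|ms vZ].
- by [].
- have <- : (if odd s then s2 else s1) = attack by exact: att.
  rewrite -tokS => v1; case e : (b (token (moves s1 s2 s.+1))).
  + by move: v1; rewrite [token _]surjective_pairing valueS -surjective_pairing e.
  + by exists s; split => //; left.
  + have [h _] := value_open t' e.
    apply: (IH t' t't s.+1 (opnS e)).2; last exact: h.
    by rewrite flip -ms; case: mover.
- have v0 := vZ ((if odd s then s2 else s1) (moves s1 s2 s)).
  rewrite -tokS in v0; case: t IH vZ v0 => [//|t] IH _ v0.
  case e : (b (token (moves s1 s2 s.+1))).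
  + by exists s; split => //; right.
  + by move: v0; rewrite [token _]surjective_pairing valueS -surjective_pairing e.
  + have [_ /(_ v0)[k hk]] := value_open t e.
    apply: (IH t (ltnSn _) s.+1 (opnS e)).1; last by exists k; apply/eqP.
    by rewrite flip; case: p ms {att IH} => //; case: mover.
Qed.

(** The state of the starting site is irrelevant for the game, hence the
    hypothesis on the positions after the first move. *)
Lemma no_draw : (exists t, forall k : 'I_m.+1, value t (step (0, 0) k) <> Unknown) ->
  ~ draw m.+1 b.
Proof.
move=> [t dec] [nF nS].
have tok0 (s1 s2 : strategy m.+1) : token (moves s1 s2 0) = (0, 0).
  by rewrite /token /= big_nil.
have opn0 (s1 s2 : strategy m.+1) u : (0 < u <= 0)%N -> b (token (moves s1 s2 u)) = Open.
  by case: u.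
have [[k k1]|none] := pselect (exists k, value t (step (0, 0) k) = One).
  apply: nF; exists attack => s2.
  have att u : mover u = First -> (if odd u then s2 else attack) = attack.
    by rewrite /mover; case: odd.
  have [h _] := attack_wins att t (opn0 _ _); apply: h => //.
  by exists k; rewrite /winning_move tok0 k1.
apply: nS; exists attack => s1.
have att u : mover u = Second -> (if odd u then attack else s1) = attack.
  by rewrite /mover; case: odd.
have [_ h] := attack_wins att t (opn0 _ _); apply: h => // k; rewrite tok0.
case e : (value t (step (0, 0) k)) => //; last by have := dec k.
by case: none; exists k.
Qed.

End Game.

(** * The game on a random board *)

Section RandomBoard.
Variables (R : realType) (m : nat) (b0 b1 : R).
Variables (d : measure_display) (Om : measurableType d) (P : probability Om R).
Variable W : int * int -> Om -> site.
Hypotheses (b0_ge0 : 0 <= b0) (b1_ge0 : 0 <= b1) (b01_le1 : b1 + b0 <= 1).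
Hypothesis iidW : iid_sites b0 b1 P W.

Local Notation undecided := (unknown_prob m b1 b0).

Definition row_values (j : int) (t : nat) (w : Om) (i : int) : letter :=
  value m (fun z => W z w) t (i, j).

Definition rows_below (j : int) (t : nat) (z : nat * int) : Om -> site :=
  W (z.2, j + t%:Z - 1 - z.1%:Z).

(** The row of values with horizon [t] is the evolution at time [t] driven by
    the rows above it in reversed order, and these are again independent
    sites. *)
Lemma iid_rows_below j t : iid_sites b0 b1 P (rows_below j t).
Proof.
apply: (iid_reindex (f := fun z : nat * int => (z.2, j + t%:Z - 1 - z.1%:Z))) iidW.
by move=> [s i] [s' i'] /= [-> h]; congr (_, _); lia.
Qed.

Lemma measurable_row_values j t i a : measurable [set w | row_values j t w i = a].
Proof. exact: (measurable_evolution m (iid_rows_below j t) t i a). Qed.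

Lemma row_values_law j t i k f : word_mean P (row_values j t) i k f = start_mean m b1 b0 t k f.
Proof. exact: (evolution_word m b0_ge0 b1_ge0 b01_le1 (iid_rows_below j t) t i k f). Qed.

Hypothesis undecided0 : undecided @ \oo --> (0 : R).

(** The events that some letter of the word is unknown at horizon [t] decrease
    with [t] and their probabilities tend to 0. *)
Lemma almost_surely_decided (i j : int) (k : nat) :
  {ae P, forall w, exists t, Unknown \notin word (row_values j t w) i k}.
Proof.
pose U t := [set w | Unknown \in word (row_values j t w) i k].
have mU t : measurable (U t).
  exact: (measurable_word (measurable_row_values j t) i k [set v : seq letter | Unknown \in v]).
have PU t : (P (U t) <= (k%:R * undecided t)%:E)%E.
  rewrite -[X in (X <= _)%E](_ : (word_mean P (row_values j t) i k (fun v => (Unknown \in v)%:R))%:E = _).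
    by rewrite row_values_law lee_fin; apply: start_mean_undecided.
  rewrite -integral_word; last exact: measurable_row_values.
  under eq_integral => w _.
    rewrite (_ : _%:R = \1_(U t) w); last first.
      rewrite indicE; congr ((nat_of_bool _)%:R).
      by apply/idP/idP => [h|/set_mem//]; rewrite inE.
    over.
  by rewrite integral_indic ?setIT.
exists (\bigcap_t U t); split.
- exact: bigcapT_measurable.
- have PI t : (P (\bigcap_t U t) <= (k%:R * undecided t)%:E)%E.
    apply: (le_trans _ (PU t)); apply: le_measure; rewrite ?inE//.
      exact: bigcapT_measurable.
    by move=> w; apply.
  have lim0 : (fun t => (k%:R * undecided t)%:E) @ \oo --> (0%R%:E : \bar R).
    apply: cvg_EFin; first by apply: nearW.
    by rewrite -(mulr0 k%:R); apply: cvgMr.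
  apply/eqP; rewrite eq_le measure_ge0 andbT.
  rewrite -[leRHS](cvg_lim _ lim0)//; apply: lime_ge; last exact: nearW.
  by apply/cvg_ex; exists 0%:E.
- move=> w /= h t _; apply: contrapT => /negP hn; apply: h; exists t.
  exact: hn.
Qed.

Lemma almost_surely_not_draw : {ae P, forall w, ~ draw m.+1 (fun z => W z w)}.
Proof.
have := almost_surely_decided 0 1 m.+1; apply: filterS => w [t ht].
apply: no_draw; exists t => k vU; move/negP: ht; apply.
apply/mapP; exists (val k); first by rewrite mem_iota /= add0n ltn_ord.
by rewrite -vU /row_values /step /= add0r.
Qed.

(** The limit of the values as the horizon grows; its law is the limit law of
    the automaton. *)
Definition final_row (w : Om) : config := fun i =>
  if `[< exists t, row_values 0 t w i = Zero >] then Zero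
  else if `[< exists t, row_values 0 t w i = One >] then One else Unknown.

Lemma final_row_value t w i : row_values 0 t w i <> Unknown ->
  final_row w i = row_values 0 t w i.
Proof.
move=> nU; have same s : row_values 0 s w i <> Unknown ->
    row_values 0 s w i = row_values 0 t w i.
  move=> sU; have [st|ts] := leqP s t; first exact/esym/(value_stable st sU).
  exact: (value_stable (ltnW ts) nU).
rewrite /final_row; case: asboolP => [[s h]|n0].
  by rewrite -(same s) h.
case: asboolP => [[s h]|n1]; first by rewrite -(same s) h.
by case e : (row_values 0 t w i) nU => // _; [case: n0|case: n1]; exists t.
Qed.

Lemma measurable_final_row i a : measurable [set w | final_row w i = a].
Proof.
have known b : b <> Unknown -> measurable [set w | final_row w i = b].
  move=> bU; rewrite (_ : [set w | _] = \bigcup_t [set w | row_values 0 t w i = b]).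
    by apply: bigcupT_measurable => t; exact: measurable_row_values.
  rewrite eqEsubset; split=> w /=; last first.
    by move=> [t _ /= h]; rewrite (@final_row_value t)// h.
  move=> h; have [t ht] : exists t, row_values 0 t w i <> Unknown.
    move: h; rewrite /final_row; case: asboolP => [[t ht] _|_]; first by exists t; rewrite ht.
    by case: asboolP => [[t ht] _|_ e]; [exists t; rewrite ht|case: bU].
  by exists t => //=; rewrite -(final_row_value ht).
case: a; [exact: known|exact: known|].
rewrite (_ : [set w | _] = ~` ([set w | final_row w i = Zero] `|` [set w | final_row w i = One])).
  by apply: measurableC; apply: measurableU; exact: known.
rewrite eqEsubset; split=> w /=; first by move=> -> [].
by case: (final_row w i) => // h; exfalso; apply: h; [left|right].
Qed.

(** The constant sequence with this law satisfies the domination hypotheses,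
    because a known value never changes. *)
Lemma final_row_law i k f : word_mean P final_row i k f = limit_mean m b1 b0 k f.
Proof.
have := @word_mean_cvg _ m b1 b0 b1_ge0 b0_ge0 b01_le1 _ _ P (fun=> final_row) i _ _ k f undecided0.
have H1 : forall (t : nat) j a, measurable [set w | final_row w j = a].
  by move=> _; exact: measurable_final_row.
have H2 t k' g : (forall v, 0 <= g v) -> (forall v, Unknown \in v -> g v = 0) ->
    start_mean m b1 b0 t k' g <= word_mean P final_row i k' g.
  move=> g0 gU; rewrite -(row_values_law 0 t i); apply: ler_sum => v _.
  case: (boolP (Unknown \in v)) => [/gU->|vK]; first by rewrite !mul0r.
  rewrite ler_wpM2l// /word_prob fine_le ?fin_num_measure//.
  - exact: (measurable_word (measurable_row_values 0 t) i k' [set v]).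
  - exact: (measurable_word measurable_final_row i k' [set v]).
  apply: le_measure; rewrite ?inE.
  - exact: (measurable_word (measurable_row_values 0 t) i k' [set v]).
  - exact: (measurable_word measurable_final_row i k' [set v]).
  move=> w /= wv; rewrite -wv; apply/eq_in_map => l lk; apply: final_row_value => hU.
  by move/negP: vK; apply; rewrite -wv; apply/mapP; exists l.
move=> /(_ H1 H2) h; apply: cvg_unique h => //; exact: cvg_cst.
Qed.

End RandomBoard.

(** * Weak convergence and conclusion *)

Definition coords (x : borel config) : int -> letter := x.

Lemma measurable_coords i a : measurable [set x : borel config | coords x i = a].
Proof. apply: sub_sigma_algebra; exact: (open_coord i [set a]). Qed.

Lemma measurable_continuous (R : realType) (f : config -> R) : continuous f ->
  measurable_fun setT (f : borel config -> R).
Proof.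
move=> cf; apply: (measurability _ (RGenOInfty.measurableE R)) => // _ [_ [x ->] <-].
rewrite setTI; apply: sub_sigma_algebra.
have [+ _] := @continuousP _ _ f; apply => //; exact: interval_open.
Qed.

Definition unblock (N : nat) (v : seq letter) : config :=
  fun i => nth Zero v (absz (i + N%:Z)).

Lemma block_unblock x N : block (unblock N (block x N)) N = block x N.
Proof.
apply/block_eqP => i iN; rewrite /unblock nth_word; last by lia.
by congr x; lia.
Qed.

Section WordConvergence.
Variable R : realType.
Implicit Types (nu : probability (borel config) R) (f : config -> R).

Lemma continuous_integrable nu f : continuous f -> (exists M, forall x, `|f x| <= M) ->
  nu.-integrable setT (EFin \o f).
Proof.
move=> cf [M fM]; apply: measurable_bounded_integrable => //.
- by rewrite (le_lt_trans (probability_le1 _ _))// ltry.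
- exact: measurable_continuous.
- exists M; split; rewrite ?num_real// => y My x _ /=.
  by rewrite (le_trans (fM x))// ltW.
Qed.

Lemma word_integrable nu i k (h : seq letter -> R) :
  nu.-integrable setT (fun x => (h (word (coords x) i k))%:E).
Proof.
have [M M0 HM] := word_bounded k h.
apply: (@measurable_bounded_integrable _ _ _ _ (fun x => h (word (coords x) i k))) => //.
- by rewrite (le_lt_trans (probability_le1 _ _))// ltry.
- move=> _ B mB; rewrite setTI.
  exact: (measurable_word measurable_coords i k [set v | B (h v)]).
- exists M; split; rewrite ?num_real// => y My x _ /=.
  by rewrite (le_trans (HM _ _)) ?size_word// ltW.
Qed.

(** Replacing [f] by its value at the configuration that has the same block
    and is 0 elsewhere changes the integral by at most [e]. *)
Lemma integral_block nu f N e : continuous f -> (exists M, forall x, `|f x| <= M) ->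
  (forall x y : config, block x N = block y N -> `|f x - f y| <= e) ->
  `|fine (\int[nu]_x (f x)%:E) - word_mean nu coords (- N%:Z) N.*2.+1 (fun v => f (unblock N v))| <= e.
Proof.
move=> cf bf fe; set g := fun v => f (unblock N v).
have fin : (\int[nu]_x (f x)%:E)%E \is a fin_num.
  exact: integrable_fin_num (continuous_integrable nu cf bf).
have close x : `|f x - g (block x N)| <= e.
  by apply: fe; rewrite block_unblock.
have shift c : word_mean nu coords (- N%:Z) N.*2.+1 g + c = word_mean nu coords (- N%:Z) N.*2.+1 (fun v => g v + c).
  rewrite -[X in X + _]mul1r -[X in _ + X]mul1r -{1}(word_mean_cst nu measurable_coords (- N%:Z) N.*2.+1 c).
  by rewrite -word_mean_lin; apply: eq_word_mean => [|v _]; [exact: measurable_coords|rewrite !mul1r].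
have up : (\int[nu]_x (f x)%:E <= (word_mean nu coords (- N%:Z) N.*2.+1 g + e)%:E)%E.
  rewrite shift -integral_word; last exact: measurable_coords.
  apply: le_integral => //; [exact: continuous_integrable|exact: (word_integrable _ _ _ (fun v => g v + e))|].
  by move=> x _; rewrite lee_fin; have := close x; rewrite ler_norml /block => /andP[]; lra.
have lo : ((word_mean nu coords (- N%:Z) N.*2.+1 g + (- e))%:E <= \int[nu]_x (f x)%:E)%E.
  rewrite shift -integral_word; last exact: measurable_coords.
  apply: le_integral => //; [exact: (word_integrable _ _ _ (fun v => g v + - e))|exact: continuous_integrable|].
  by move=> x _; rewrite lee_fin; have := close x; rewrite ler_norml /block => /andP[]; lra.
move: up lo; rewrite -{1 2}(fineK fin) !lee_fin => up lo.
by rewrite ler_norml; apply/andP; split; lra.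
Qed.

Lemma weak_cvg_words (mu : nat -> probability (borel config) R) nu :
  (forall i k h, (fun t => word_mean (mu t) coords i k h) @ \oo --> word_mean nu coords i k h) ->
  weak_cvg mu nu.
Proof.
move=> H f cf bf.
have fin (rho : probability (borel config) R) : (\int[rho]_x (f x)%:E)%E \is a fin_num.
  exact: integrable_fin_num (continuous_integrable rho cf bf).
rewrite -(fineK (fin nu)); apply: cvg_EFin; first by apply: nearW => t; exact: fin.
apply/cvgrPdist_le => e e0.
have e3 : 0 < e / 3 by lra.
have [N HN] := uniform_block cf e3.
have h1 := integral_block nu cf bf HN.
have := H (- N%:Z) N.*2.+1 (fun v => f (unblock N v)).
move=> /cvgrPdist_le /(_ _ e3); apply: filterS => t ht.
have h2 := integral_block (mu t) cf bf HN.
move: h1 h2 ht; rewrite /= !ler_norml => /andP[h1 h1'] /andP[h2 h2'] /andP[h3 h3'].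
by apply/andP; split; lra.
Qed.

(** Indicators of sets that depend on a block are continuous, so the two limits
    agree on these sets, which are stable under intersection and generate the
    Borel sets. *)
Lemma weak_cvg_unique (mu : nat -> probability (borel config) R) nu nu' :
  weak_cvg mu nu -> weak_cvg mu nu' -> forall B, measurable B -> nu B = nu' B.
Proof.
move=> H H' B mB.
pose clopen : set (set (borel config)) := [set A | exists N, forall x y : config,
  block x N = block y N -> A x -> A y].
have openA A : clopen A -> open (A : set config).
  move=> [N HN]; rewrite openE => x Ax; rewrite /interior.
  by apply: filterS (nbhs_blockeq x N) => y xy; apply: HN Ax.
have mA A : clopen A -> measurable A by move=> /openA oA; exact: sub_sigma_algebra.
have same A : clopen A -> nu A = nu' A.
  move=> cA; have [N HN] := cA.
  have cf : continuous (\1_A : config -> R).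
    move=> x; apply: cvg_near_cst; apply: filterS (nbhs_blockeq x N) => y xy.
    rewrite !indicE; congr ((nat_of_bool _)%:R).
    by apply/idP/idP; rewrite !inE; apply: HN.
  have bf : exists M : R, forall x : config, `|\1_A x| <= M.
    by exists 1 => x; rewrite indicE; case: (_ \in _); rewrite ?normr1 ?normr0.
  have := cvg_unique _ (H _ cf bf) (H' _ cf bf).
  by rewrite !integral_indic ?setIT//; [apply|exact: mA|exact: mA].
apply: (@g_sigma_algebra_measure_unique _ _ _ clopen mA (fun=> setT)) => //.
- by move=> _; exists 0%N.
- by rewrite bigcup_const.
- move=> A A' [N HN] [N' HN']; exists (maxn N N') => x y xy [Ax A'x]; split.
    by apply: HN Ax; apply: block_le xy; exact: leq_maxl.
  by apply: HN' A'x; apply: block_le xy; exact: leq_maxr.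
- by move=> _; rewrite (le_lt_trans (probability_le1 _ _))// ltry.
move: B mB; apply: smallest_sub; first exact: smallest_sigma_algebra.
move=> U oU; rewrite (open_blocks oU).
apply: (@bigcupT_measurable _ (g_sigma_algebraType clopen)) => N.
apply: sub_sigma_algebra; exists N => x y xy [v vw [xv h]].
by exists v => //; split => //; rewrite -xy.
Qed.

End WordConvergence.

Section Ergodicity.
Variables (R : realType) (m : nat) (e0 e1 : R).
Hypotheses (e0_ge0 : 0 <= e0) (e1_ge0 : 0 <= e1) (e01_le1 : e0 + e1 <= 1).
Hypothesis undecided0 :
  unknown_prob m e0 e1 @ \oo --> (0 : R).

(** Uniqueness needs one chain to compare two attracting measures; the
    evolution driven by independent sites provides it. *)
Lemma ergodic_of_unknown_prob : ergodic m.+1 e0 e1.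
Proof.
have e10_le1 : e1 + e0 <= 1 by rewrite addrC.
have iidW := iid_digit_board e1_ge0 e0_ge0 e10_le1 (int * int)%type.
set P := uniform_prob _ in iidW; set W := digit_board e1 e0 (I := _) in iidW.
have mV : measurable_fun setT (final_row m W : _ -> borel config).
  move=> _ B mB; rewrite setTI; apply: measurable_borel mB.
  exact: (measurable_final_row m e1_ge0 e0_ge0 e01_le1 iidW).
pose V := random_variable P mV.
exists (distribution P V).
have attr : attracting m.+1 e0 e1 (distribution P V).
  move=> mu0 d Om P' X chainX _; apply: weak_cvg_words => i k f.
  rewrite [X in _ --> X](final_row_law e1_ge0 e0_ge0 e01_le1 iidW undecided0 i k f).
  apply: (word_mean_cvg e0_ge0 e1_ge0 e01_le1 (measurable_chain X)) => // t k' g.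
  exact: (word_mean_known_ge e0_ge0 e1_ge0 e01_le1 chainX).
split=> // nu nu_attr.
have iidN := iid_digit_board e1_ge0 e0_ge0 e10_le1 (nat * int)%type.
pose X := evolution_rv m iidN.
have chainX : pca_chain m.+1 e0 e1 X by exact: evolution_chain.
exact: weak_cvg_unique (nu_attr _ _ _ _ X chainX (fun _ _ => erefl))
  (attr _ _ _ _ X chainX (fun _ _ => erefl)).
Qed.

End Ergodicity.

Lemma unknown_prob_cvg0 (R : realType) (m : nat) (e0 e1 : R) :
  m = 1%N \/ m = 2%N -> 0 <= e0 <= 2^-1 -> 0 <= e1 <= 2^-1 -> ~ (e0 = 0 /\ e1 = 0) ->
  unknown_prob m e0 e1 @ \oo --> (0 : R).
Proof.
move=> m12 /andP[e0_ge0 e0_half] /andP[e1_ge0 e1_half] e_neq0.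
have e01_le1 : e0 + e1 <= 1 by lra.
suff <- : limit_mean m e0 e1 1 (fun u => (u == [:: Unknown])%:R) = 0 by exact: limit_mean_cvg.
case: m12 => ->.
  by rewrite -[RHS](two_unknown_vanishes e0_ge0 e1_ge0 e01_le1 e_neq0) pr_starts_take.
by rewrite -[RHS](three_unknown_vanishes e0_ge0 e1_ge0 e01_le1 e_neq0 e0_half) pr_starts_take.
Qed.

Theorem theorem1 (R : realType) (n : nat) (e0 e1 : R) :
  n = 2%N \/ n = 3%N ->
  0 <= e0 <= 2^-1 -> 0 <= e1 <= 2^-1 -> ~ (e0 = 0 /\ e1 = 0) ->
  ergodic n e0 e1 /\ almost_surely_no_draw n e0 e1.
Proof.
move=> n23 he0 he1 e_neq0.
have [m -> m12] : exists2 m, n = m.+1 & m = 1%N \/ m = 2%N.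
  by case: n23 => ->; [exists 1%N; [|left]|exists 2%N; [|right]].
have u01 := unknown_prob_cvg0 m12 he0 he1 e_neq0.
have e_neq0' : ~ (e1 = 0 /\ e0 = 0) by move=> [? ?]; exact: e_neq0.
have u10 := unknown_prob_cvg0 m12 he1 he0 e_neq0'.
move: he0 he1 => /andP[e0_ge0 e0_half] /andP[e1_ge0 e1_half].
split; first by apply: ergodic_of_unknown_prob => //; lra.
move=> d Om P W iidW.
by apply: (almost_surely_not_draw e0_ge0 e1_ge0 _ iidW u10); lra.
Qed.
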